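(* For the $T^2$-action on the nearly Kähler flag manifold $F_{1,2}(\mathbb{C}^3)=\mathrm{SU}(3)/T^2$ with multi-moment map $\nu_{F_{1,2}(\mathbb{C}^3)}$ described in the context, the orbit space $\nu_{F_{1,2}(\mathbb{C}^3)}^{-1}(0)/T^2$ can be identified with (i.e. is homeomorphic to) $F_{1,2}(\mathbb{R}^3)/\mathbb{Z}_2^2$.
   Context: $F_{1,2}(\mathbb{C}^3)$ is the manifold of pairs $(L,\Pi)$ of complex subspaces of $\mathbb{C}^3$ with $\dim L=1$, $\dim\Pi=2$, $L\subset\Pi$; it is diffeomorphic to $\mathrm{SU}(3)/T^2$, where $T^2$ is the diagonal maximal torus. $F_{1,2}(\mathbb{R}^3)$ is the analogous manifold of real flags. Nearly Kähler structure: write $\mathfrak{su}(3)=\mathfrak{t}^2\oplus\mathfrak{m}$, with $\mathfrak{m}$ the matrices with zero diagonal. On $\mathfrak{m}$ put $g_0(X,Y)=\mathrm{Re}\,\tfrac12\mathrm{Tr}(\overline{X}^{t}Y)$ and $J_0X=\tfrac{2}{\sqrt3}\bigl(AXA^{-1}+\tfrac12X\bigr)$ with $A=\mathrm{diag}(e^{2\pi i/3},e^{4\pi i/3},1)$, and $\sigma_0=g_0(J_0\cdot,\cdot)$; these are extended by left translation to $\mathrm{SU}(3)$-invariant tensors $g,J,\sigma$ on $\mathrm{SU}(3)/T^2$. The torus $T^2=\{\mathrm{diag}(e^{i\vartheta},e^{i\varphi},e^{-i(\vartheta+\varphi)})\}\subset\mathrm{SU}(3)$ acts on $\mathrm{SU}(3)/T^2$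 by left multiplication. With the basis $U=\mathrm{diag}(-i,2i,-i)$, $V=\mathrm{diag}(-i,-i,2i)$ of its Lie algebra, the multi-moment map at the coset of $p=(p_{ij})\in\mathrm{SU}(3)$ is $\nu_{F_{1,2}(\mathbb{C}^3)}(p)=\sigma_0\bigl((p^{-1}Up)_{\mathfrak{m}},(p^{-1}Vp)_{\mathfrak{m}}\bigr)$, where the subscript $\mathfrak{m}$ denotes projection onto $\mathfrak{m}$. It equals $-27\,\mathrm{Im}(p_{22}\overline{p}_{23}\overline{p}_{32}p_{33})$. $\mathbb{Z}_2^2$ is the real part of $T^2$, i.e. the group of diagonal matrices with entries $\pm1$ and determinant $1$, acting on $F_{1,2}(\mathbb{R}^3)$ through its linear action on $\mathbb{R}^3$. *)

(* Defs.v *)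
From HB Require Import structures.
From mathcomp Require Import all_boot all_order all_algebra.
From mathcomp Require Import all_classical all_reals all_analysis.
From mathcomp Require Import complex.

Set Implicit Arguments.
Unset Strict Implicit.
Unset Printing Implicit Defensive.

Import Order.TTheory GRing.Theory Num.Theory numFieldNormedType.Exports.

Local Open Scope classical_set_scope.
Local Open Scope ring_scope.
Local Open Scope complex_scope.
Local Open Scope quotient_scope.
Local Open Scope sesquilinear_scope.

(* MathComp-Analysis puts the norm topology on [K^o] for [K] a [numFieldType];
   this transports it to the carrier [R[i]], hence to matrices over it. *)
HB.instance Definition _ (R : rcfType) := NormedModule.copy R[i] R[i]^o.

Definition homeomorphic (X Y : topologicalType) : Prop :=
  exists (f : X -> Y) (g : Y -> X),
    [/\ cancel f g, cancel g f, continuous f & continuous g].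

Section OrbitSpace.
Context {G : Type} {X : topologicalType}.
Implicit Types act : G -> X -> X.

(* The maps [act g] form a group under composition.  This is stated without a
   group structure on [G], so that left and right actions are both covered. *)
Record transformation_group act : Prop := TransformationGroup {
  tg_one : exists e, act e =1 id;
  tg_inv : forall g, exists h, cancel (act g) (act h);
  tg_mul : forall g h, exists k, act g \o act h =1 act k }.

Definition orbit_rel act (x y : X) : bool := `[< exists g, y = act g x >].

Context {act : G -> X -> X} (tg : transformation_group act).

Lemma orbit_rel_refl : reflexive (orbit_rel act).
Proof. by move=> x; apply/asboolP; have [e eP] := tg_one tg; exists e. Qed.

Lemma orbit_rel_sym : symmetric (orbit_rel act).
Proof.
suff sub x y : orbit_rel act x y -> orbit_rel act y x.
  by move=> x y; apply/idP/idP; exact: sub.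
move=> /asboolP[g ->]; apply/asboolP.
by have [h hK] := tg_inv tg g; exists h.
Qed.

Lemma orbit_rel_trans : transitive (orbit_rel act).
Proof.
move=> y x z /asboolP[g ->] /asboolP[h ->]; apply/asboolP.
by have [k kP] := tg_mul tg h g; exists k; rewrite -kP.
Qed.

Definition orbit_equiv : equiv_rel X :=
  EquivRel (orbit_rel act) orbit_rel_refl orbit_rel_sym orbit_rel_trans.

Definition orbit_space : Type := {eq_quot orbit_equiv}.

HB.instance Definition _ := Topological.copy orbit_space
  (quotient_topology {eq_quot orbit_equiv}).
HB.instance Definition _ := Quotient.on orbit_space.

Lemma eq_orbit (x y : X) :
  (\pi_orbit_space x = \pi_orbit_space y) <-> (exists g, y = act g x).
Proof.
split=> [/eqquotP/asboolP//|xy].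
exact/eqquotP/asboolP.
Qed.

Lemma pi_orbit g (x : X) : \pi_orbit_space (act g x) = \pi_orbit_space x.
Proof. by apply/esym/eq_orbit; exists g. Qed.

Lemma repr_orbit (x : X) :
  exists g, repr (\pi_orbit_space x) = act g x.
Proof. by apply/eq_orbit; rewrite reprK. Qed.

End OrbitSpace.

Section FlagManifoldC.
Context {R : realType}.
Local Notation C := R[i].
Implicit Types X Y : 'M[C]_3.

Definition diag3 (a b c : C) : 'M[C]_3 :=
  diag_mx (\row_(j < 3) [:: a; b; c]`_j).

Definition cis (a : R) : C := cos a +i* sin a.

Definition SU3 : set 'M[C]_3 := [set p | p \is unitarymx /\ \det p = 1].

Definition torus_mx (a b : R) : 'M[C]_3 :=
  diag3 (cis a) (cis b) (cis (- (a + b))).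

Definition T2 : set 'M[C]_3 := [set t | exists a b, t = torus_mx a b].

Lemma cisD a b : cis (a + b) = cis a * cis b.
Proof.
rewrite /cis cosD sinD; apply/eqP; rewrite eq_complex /= eqxx /=.
by rewrite addrC.
Qed.

Lemma cis0 : cis 0 = 1.
Proof. by rewrite /cis cos0 sin0. Qed.

Lemma conj_cis a : Num.conj (cis a) = cis (- a).
Proof. by rewrite /cis cosN sinN. Qed.

Lemma diag3M a b c d e f :
  diag3 a b c *m diag3 d e f = diag3 (a * d) (b * e) (c * f).
Proof.
rewrite /diag3 mulmx_diag; congr diag_mx; apply/rowP=> -[[|[|[|//]]] ?];
  by rewrite !mxE.
Qed.

Lemma torus_mxM a b c d :
  torus_mx a b *m torus_mx c d = torus_mx (a + c) (b + d).
Proof. by rewrite diag3M -!cisD -opprD addrACA. Qed.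

Lemma torus_mx0 : torus_mx 0 0 = 1%:M.
Proof.
rewrite /torus_mx addr0 oppr0 cis0 -diag_const_mx; congr diag_mx.
by apply/rowP=> -[[|[|[|//]]] ?]; rewrite !mxE.
Qed.

Lemma torus_mxV a b : torus_mx a b *m torus_mx (- a) (- b) = 1%:M.
Proof. by rewrite torus_mxM !subrr torus_mx0. Qed.

Lemma torus_mx_adj a b : (torus_mx a b)^t* = torus_mx (- a) (- b).
Proof.
rewrite /torus_mx /diag3 tr_diag_mx map_diag_mx; congr diag_mx.
by apply/rowP=> -[[|[|[|//]]] ?]; rewrite !mxE /= conj_cis// -opprD.
Qed.

Lemma T2_SU3 : T2 `<=` SU3.
Proof.
move=> _ [a [b ->]]; split.
  by apply/unitarymxP; rewrite torus_mx_adj torus_mxV.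
rewrite det_diag !big_ord_recl big_ord0 !mxE /= mulr1 -!cisD.
by rewrite addrA subrr cis0.
Qed.

Lemma SU3M p q : SU3 p -> SU3 q -> SU3 (p *m q).
Proof.
move=> [pU dp] [qU dq]; split; first exact: mul_unitarymx.
by rewrite det_mulmx dp dq mulr1.
Qed.

Definition mulSU3 (p q : SU3) : SU3 :=
  exist _ (val p *m val q)
    (mem_set (SU3M (set_mem (valP p)) (set_mem (valP q)))).

Definition torus_SU3 (t : T2) : SU3 :=
  exist _ (val t) (mem_set (T2_SU3 (set_mem (valP t)))).

Definition torus_elt (a b : R) : T2 :=
  exist _ (torus_mx a b)
    (mem_set (ex_intro _ a (ex_intro _ b erefl))).

Lemma torus_eltP (t : T2) : exists a b, t = torus_elt a b.
Proof.
case: t => t tT; have [a [b tE]] := set_mem tT.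
by exists a, b; apply/val_inj.
Qed.

Lemma mulSU3A : associative mulSU3.
Proof. by move=> p q r; apply/val_inj; rewrite /= mulmxA. Qed.

Definition rtorus (t : T2) (p : SU3) : SU3 := mulSU3 p (torus_SU3 t).

Lemma rtorus_tg : transformation_group rtorus.
Proof.
split.
- by exists (torus_elt 0 0) => p; apply/val_inj; rewrite /= torus_mx0 mulmx1.
- move=> t; have [a [b ->]] := torus_eltP t; exists (torus_elt (- a) (- b)) => p.
  by apply/val_inj; rewrite /= -mulmxA torus_mxV mulmx1.
- move=> t u; have [a [b ->]] := torus_eltP t; have [c [d ->]] := torus_eltP u.
  exists (torus_elt (c + a) (d + b)) => p.
  by apply/val_inj; rewrite /= -mulmxA torus_mxM.
Qed.

(* F_{1,2}(C^3) = SU(3)/T^2 *)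
Definition flagC : topologicalType := orbit_space rtorus_tg.

Local Notation coset p := (\pi_(orbit_space rtorus_tg) p : flagC).

(* Independent of the representative, by [ltorusE] below; likewise [nu] and
   [nuE]. *)
Definition ltorus (t : T2) (x : flagC) : flagC :=
  coset (mulSU3 (torus_SU3 t) (repr x)).

Lemma ltorusE (t : T2) (p : SU3) : ltorus t (coset p) = coset (mulSU3 (torus_SU3 t) p).
Proof.
rewrite /ltorus; have [u ->] := repr_orbit rtorus_tg p.
by rewrite /rtorus mulSU3A; exact: pi_orbit.
Qed.

(* Zeroing the diagonal; on su(3) this is the projection onto m along t^2. *)
Definition m_proj X : 'M[C]_3 := \matrix_(i, j) (if i == j then 0 else X i j).

Definition g0 X Y : R := complex.Re (2^-1 * \tr (X^t* *m Y)).

Definition A0 : 'M[C]_3 := diag3 (cis (2 * pi / 3)) (cis (4 * pi / 3)) 1.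

Definition J0 X : 'M[C]_3 :=
  (2 / Num.sqrt 3)%:C *: (A0 *m X *m invmx A0 + 2^-1 *: X).

Definition sigma0 X Y : R := g0 (J0 X) Y.

Definition U0 : 'M[C]_3 := diag3 (- 'i) (2 * 'i) (- 'i).
Definition V0 : 'M[C]_3 := diag3 (- 'i) (- 'i) (2 * 'i).

Definition nu_mx (p : 'M[C]_3) : R :=
  sigma0 (m_proj (invmx p *m U0 *m p)) (m_proj (invmx p *m V0 *m p)).

Definition nu (x : flagC) : R := nu_mx (val (repr x)).

Lemma diag3C a b c d e f : comm_mx (diag3 a b c) (diag3 d e f).
Proof. by rewrite /comm_mx !diag3M ![_ * d]mulrC ![_ * e]mulrC ![_ * f]mulrC. Qed.

Lemma torus_unit a b : torus_mx a b \in unitmx.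
Proof. by have [] := mulmx1_unit (torus_mxV a b). Qed.

Lemma invmx_torus a b : invmx (torus_mx a b) = torus_mx (- a) (- b).
Proof.
by rewrite -[RHS](mulKmx (torus_unit a b)) torus_mxV mulmx1.
Qed.

Lemma m_proj_conj a b X :
  m_proj (torus_mx (- a) (- b) *m X *m torus_mx a b) =
  torus_mx (- a) (- b) *m m_proj X *m torus_mx a b.
Proof.
apply/matrixP=> i j.
rewrite /torus_mx /diag3 mul_diag_mx !mul_mx_diag mxE.
by rewrite mul_diag_mx !mxE; case: eqP; rewrite ?mulr0 ?mul0r.
Qed.

Lemma A0_unit : A0 \in unitmx.
Proof.
have cis_neq0 a : cis a != 0.
  apply: contra_eq_neq (cisD a (- a)) => ->.
  by rewrite subrr cis0 mul0r oner_eq0.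
rewrite unitmxE det_diag !big_ord_recl big_ord0 !mxE /= !mulr1.
by rewrite unitfE mulf_neq0.
Qed.

Lemma J0_conj a b X :
  J0 (torus_mx (- a) (- b) *m X *m torus_mx a b) =
  torus_mx (- a) (- b) *m J0 X *m torus_mx a b.
Proof.
have At c d : A0 *m torus_mx c d = torus_mx c d *m A0 by exact: diag3C.
have tA c d : torus_mx c d *m invmx A0 = invmx A0 *m torus_mx c d.
  by rewrite -[LHS](mulKmx A0_unit) (mulmxA A0) At mulmxK ?A0_unit.
rewrite /J0 -!scalemxAr -scalemxAl mulmxDr mulmxDl -scalemxAr -scalemxAl.
by rewrite !mulmxA At -!mulmxA tA !mulmxA.
Qed.

Lemma g0_conj a b X Y :
  g0 (torus_mx (- a) (- b) *m X *m torus_mx a b)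
     (torus_mx (- a) (- b) *m Y *m torus_mx a b) = g0 X Y.
Proof.
rewrite /g0 !trmx_mul !map_mxM !torus_mx_adj !opprK.
rewrite !mulmxA mxtrace_mulC !mulmxA torus_mxV mul1mx.
by rewrite -!mulmxA (mulmxA (torus_mx a b)) torus_mxV mul1mx.
Qed.

Lemma nu_mx_right p a b : p \in unitmx -> nu_mx (p *m torus_mx a b) = nu_mx p.
Proof.
move=> pU; have invM : invmx (p *m torus_mx a b) = torus_mx (- a) (- b) *m invmx p.
  rewrite -[RHS](mulmxK (_ : p *m torus_mx a b \in unitmx)); last first.
    by rewrite unitmx_mul pU torus_unit.
  rewrite -!mulmxA (mulmxA (invmx p)) mulVmx // mul1mx.
  by rewrite mulmxA torus_mxM !addNr torus_mx0 mul1mx.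
have conjE W : invmx (p *m torus_mx a b) *m W *m (p *m torus_mx a b) =
    torus_mx (- a) (- b) *m (invmx p *m W *m p) *m torus_mx a b.
  by rewrite invM !mulmxA.
by rewrite /nu_mx /sigma0 !conjE !m_proj_conj J0_conj g0_conj.
Qed.

Lemma nu_mx_left p a b : p \in unitmx -> nu_mx (torus_mx a b *m p) = nu_mx p.
Proof.
move=> pU; have invM : invmx (torus_mx a b *m p) = invmx p *m torus_mx (- a) (- b).
  rewrite -[RHS](mulmxK (_ : torus_mx a b *m p \in unitmx)); last first.
    by rewrite unitmx_mul pU torus_unit.
  rewrite -!mulmxA (mulmxA (torus_mx (- a) (- b))) torus_mxM !addNr torus_mx0.
  by rewrite mul1mx mulmxA mulVmx // mul1mx.
have conjE d e f : invmx (torus_mx a b *m p) *m diag3 d e f *m (torus_mx a b *m p)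
    = invmx p *m diag3 d e f *m p.
  rewrite invM -!mulmxA; congr (_ *m _).
  rewrite (mulmxA _ (torus_mx a b)) (diag3C d e f) -!mulmxA.
  by rewrite (mulmxA (torus_mx (- a) (- b))) torus_mxM !addNr torus_mx0 mul1mx.
by rewrite /nu_mx !conjE.
Qed.

Lemma SU3_unit (p : SU3) : val p \in unitmx.
Proof. by apply: unitarymx_unit; have [] := set_mem (valP p). Qed.

Lemma nuE (p : SU3) : nu (coset p) = nu_mx (val p).
Proof.
rewrite /nu; have [t ->] := repr_orbit rtorus_tg p.
by have [a [b ->]] := torus_eltP t; rewrite /= nu_mx_right // SU3_unit.
Qed.

Lemma nu_ltorus t x : nu (ltorus t x) = nu x.
Proof.
rewrite /ltorus nuE /= /nu; have [a [b ->]] := torus_eltP t.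
by rewrite nu_mx_left // SU3_unit.
Qed.

Definition nu_zero : set flagC := [set x | nu x = 0].

Lemma nu_zero_ltorus t x : nu_zero x -> nu_zero (ltorus t x).
Proof. by rewrite /nu_zero /= nu_ltorus. Qed.

Definition ltorus_nu_zero (t : T2) (x : nu_zero) : nu_zero :=
  exist _ (ltorus t (val x)) (mem_set (nu_zero_ltorus t (set_mem (valP x)))).

Lemma ltorus_nu_zero_tg : transformation_group ltorus_nu_zero.
Proof.
have mulE t u x : ltorus t (ltorus u x) =
    coset (mulSU3 (mulSU3 (torus_SU3 t) (torus_SU3 u)) (repr x)).
  by rewrite -mulSU3A -ltorusE.
have eqC (p q : SU3) : val p = val q -> coset p = coset q.
  by move=> /val_inj ->.
split.
- exists (torus_elt 0 0) => x; apply/val_inj => /=.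
  rewrite -[RHS]reprK; apply: eqC => /=.
  by rewrite torus_mx0 mul1mx.
- move=> t; have [a [b ->]] := torus_eltP t; exists (torus_elt (- a) (- b)) => x.
  apply/val_inj => /=; rewrite mulE -[RHS]reprK; apply: eqC => /=.
  by rewrite torus_mxM !addNr torus_mx0 mul1mx.
- move=> t u; have [a [b ->]] := torus_eltP t; have [c [d ->]] := torus_eltP u.
  exists (torus_elt (a + c) (b + d)) => x.
  apply/val_inj => /=; rewrite mulE; apply: eqC => /=.
  by rewrite torus_mxM.
Qed.

End FlagManifoldC.

Section FlagManifoldR.
Context {R : realType}.
Local Notation V := 'cV[R]_3.

Definition is_flag (x : {vspace V} * {vspace V}) : bool :=
  [&& \dim x.1 == 1, \dim x.2 == 2 & (x.1 <= x.2)%VS]%N.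

Definition flagR : Type := {x : {vspace V} * {vspace V} | is_flag x}.

HB.instance Definition _ := Choice.on flagR.

Definition frameR : set (V * V) := [set v | free [:: v.1; v.2]].

Lemma is_flag_span (v : frameR) :
  is_flag (<[(val v).1]>%VS, <<[:: (val v).1; (val v).2]>>%VS).
Proof.
have vfree : free [:: (val v).1; (val v).2] := set_mem (valP v).
apply/and3P; split => /=.
- have v0 : (val v).1 != 0.
    by apply: contraTneq vfree => ->; rewrite free_cons mem0v.
  by rewrite dim_vline v0.
- exact: vfree.
- by rewrite span_cons addvSl.
Qed.

Definition flag_of_frame (v : frameR) : flagR :=
  exist is_flag _ (is_flag_span v).

(* Manifold topology of F_{1,2}(R^3): the quotient topology for the surjection
   from the Stiefel manifold of linearly independent pairs (v1, v2) sending it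
   to (span v1, span (v1, v2)). *)
Definition flagR_open (U : set flagR) : Prop := open (flag_of_frame @^-1` U).

Lemma flagR_openT : flagR_open setT.
Proof. by rewrite /flagR_open preimage_setT; exact: openT. Qed.

Lemma flagR_openI (U W : set flagR) :
  flagR_open U -> flagR_open W -> flagR_open (U `&` W).
Proof. exact: openI. Qed.

Lemma flagR_open_bigU (I : Type) (f : I -> set flagR) :
  (forall i, flagR_open (f i)) -> flagR_open (\bigcup_i f i).
Proof. by move=> fo; apply: bigcup_open => i _; exact: fo. Qed.

HB.instance Definition _ :=
  isOpenTopological.Build flagR flagR_openT flagR_openI flagR_open_bigU.

Lemma flag_of_frame_surj (x : flagR) : exists v, flag_of_frame v = x.
Proof.
case: x => -[L W] /= LW; have /and3P[/= /eqP dL /eqP dW sLW] := LW.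
pose v := vpick L.
have v0 : v != 0 by rewrite vpick0 -dimv_eq0 dL.
have vL : (<[v]> = L)%VS.
  by apply/eqP; rewrite eqEdim dim_vline v0 dL leqnn andbT -memvE memv_pick.
have /subvPn[w wW wL] : ~~ (W <= L)%VS.
  by apply/negP => /dimvS; rewrite dL dW.
have vw : free [:: v; w].
  rewrite (perm_free (_ : perm_eq _ [:: w; v])) ?(perm_catC [:: v])//.
  by rewrite free_cons span_seq1 vL wL seq1_free v0.
exists (exist _ (v, w) (mem_set (vw : frameR (v, w)))); apply/val_inj => /=.
congr (_, _) => //; apply/eqP; rewrite eqEdim dW (eqP vw) leqnn andbT.
rewrite span_cons span_seq1 subv_add -!memvE wW andbT.
exact: subvP sLW _ (memv_pick L).
Qed.

Definition Z22 : set 'M[R]_3 :=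
  [set s | [/\ is_diag_mx s, forall i, s i i = 1 \/ s i i = -1 & \det s = 1]].

Lemma Z22M s t : Z22 s -> Z22 t -> Z22 (s *m t).
Proof.
move=> [/diag_mxP[d ->] ds1 ds] [/diag_mxP[e ->] dt1 dt]; split.
- by rewrite mulmx_diag diag_mx_is_diag.
- move=> i; move: (ds1 i) (dt1 i); rewrite mulmx_diag !mxE eqxx !mulr1n.
  by move=> [->|->] [->|->]; rewrite ?mulrNN ?mulr1 ?mul1r; [left|right|right|left].
- by rewrite det_mulmx ds dt mulr1.
Qed.

Lemma Z22_sqr s : Z22 s -> s *m s = 1%:M.
Proof.
move=> [/diag_mxP[d ->] ds1 _]; rewrite mulmx_diag -diag_const_mx.
congr diag_mx; apply/rowP => i; move: (ds1 i).
by rewrite !mxE eqxx !mulr1n => -[->|->]; rewrite ?mulrNN mulr1.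
Qed.

Lemma Z22_1 : Z22 1%:M.
Proof.
split; [exact: scalar_mx_is_diag| |exact: det1].
by move=> i; left; rewrite mxE eqxx.
Qed.

Definition mx_image (s : 'M[R]_3) (W : {vspace V}) : {vspace V} :=
  (linfun (mulmx s) @: W)%VS.

Lemma mx_imageM s t W : mx_image s (mx_image t W) = mx_image (s *m t) W.
Proof.
rewrite /mx_image -limg_comp; congr (lfun_img _ _).
by apply/lfunP => v; rewrite comp_lfunE !lfunE /= mulmxA.
Qed.

Lemma mx_image1 W : mx_image 1%:M W = W.
Proof.
rewrite /mx_image -[RHS]lim1g; congr (lfun_img _ _).
by apply/lfunP => v; rewrite id_lfunE lfunE /= mul1mx.
Qed.

Lemma is_flag_image s (x : {vspace V} * {vspace V}) : Z22 s ->
  is_flag x -> is_flag (mx_image s x.1, mx_image s x.2).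
Proof.
move=> sZ /and3P[d1 d2 x12].
have ker0 : lker (linfun (mulmx s) : 'Hom(V, V)) == 0%VS.
  apply/lker0P => u v; rewrite !lfunE /= => /(congr1 (mulmx s)).
  by rewrite !mulmxA Z22_sqr // !mul1mx.
have dimE W : \dim (mx_image s W) = \dim W.
  by apply: limg_dim_eq; rewrite (eqP ker0) capv0.
by rewrite /is_flag /= !dimE d1 d2 limgS.
Qed.

Definition Z22_act (s : Z22) (x : flagR) : flagR :=
  exist is_flag _ (is_flag_image (set_mem (valP s)) (valP x)).

Lemma Z22_act_tg : transformation_group Z22_act.
Proof.
have ext (x y : flagR) : val x = val y -> x = y by exact: val_inj.
split.
- exists (SigSub (mem_set Z22_1) : Z22) => x; apply: ext => /=.
  by rewrite !mx_image1; case: (val x).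
- move=> s; exists s => x; apply: ext => /=.
  by rewrite !mx_imageM !(Z22_sqr (set_mem (valP s))) !mx_image1; case: (val x).
- move=> s t.
  exists (SigSub (mem_set (Z22M (set_mem (valP s)) (set_mem (valP t)))) : Z22) => x.
  by apply: ext; rewrite /= !mx_imageM.
Qed.

End FlagManifoldR.

(* nu^{-1}(0) / T^2, with nu^{-1}(0) carrying the subspace topology *)
Definition nu_zero_orbits (R : realType) : topologicalType :=
  orbit_space (@ltorus_nu_zero_tg R).

(* F_{1,2}(R^3) / Z_2^2 *)
Definition flagR_orbits (R : realType) : topologicalType :=
  orbit_space (@Z22_act_tg R).

(* Main.v *)
(* Both orbit spaces are quotients of SO(3), by the two-sided action of the group
   of diagonal sign matrices of determinant 1: a real flag is the class of an
   orthonormal frame, and q in SO(3) is also an element of SU(3) on which nu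
   vanishes.
   - Every zero of nu comes from SO(3): nu(p) is a nonzero multiple of
     Im(z_0 conj z_1), where z_j = p_1j conj(p_2j) (indices from 0) and
     z_0 + z_1 + z_2 = 0 because rows 1 and 2 of p are orthogonal.  If nu(p) = 0,
     all z_j lie on one real line, so phases of rows and columns make rows 1 and
     2 real; row 0, their conjugate cross product, then is real as well.
   - If q' = t q u with q, q' real and t, u in the torus, then t and u may be
     replaced by signs.
   - The map from SO(3) to the real flags is a quotient map because Gram-Schmidt
     is a continuous section on frames; the map to nu^{-1}(0) / T^2 is one
     because T^2 F T^2 is compact for every closed F in SO(3). *)

Require Import Defs.
From mathcomp Require Import all_boot all_order all_algebra.
From mathcomp Require Import all_classical all_reals all_analysis.
From mathcomp Require Import complex ring lra.

Set Implicit Arguments.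
Unset Strict Implicit.
Unset Printing Implicit Defensive.

Import Order.TTheory GRing.Theory Num.Theory numFieldNormedType.Exports.

Local Open Scope classical_set_scope.
Local Open Scope ring_scope.
Local Open Scope complex_scope.
Local Open Scope quotient_scope.
Local Open Scope sesquilinear_scope.

(** * Quotient maps and topology of matrices *)

(** The two bijections are built from arbitrary, possibly discontinuous, sections [fi] and [gi].
    Continuity is tested after composing with a quotient map, where the section disappears because
    the fibres agree. *)
Lemma homeomorphic_quotient_maps (A X Y : topologicalType)
    (f : A -> X) (g : A -> Y) :
  (forall x, exists a, f a = x) -> (forall y, exists a, g a = y) ->
  (forall a b, f a = f b <-> g a = g b) ->
  (forall U, open (f @^-1` U) <-> open U) ->
  (forall U, open (g @^-1` U) <-> open U) ->
  homeomorphic X Y.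
Proof.
move=> /choice[fi fiK] /choice[gi giK] fg fq gq.
have gE a : g (fi (f a)) = g a by apply/fg; rewrite fiK.
have fE a : f (gi (g a)) = f a by apply/fg; rewrite giK.
exists (g \o fi), (f \o gi); split.
- by move=> x; rewrite /= fE fiK.
- by move=> y; rewrite /= gE giK.
- apply/continuousP => U oU; apply/fq.
  rewrite (_ : _ @^-1` _ = g @^-1` U); first exact/gq.
  by apply/seteqP; split => a /=; rewrite gE.
- apply/continuousP => U oU; apply/gq.
  rewrite (_ : _ @^-1` _ = f @^-1` U); first exact/fq.
  by apply/seteqP; split => a /=; rewrite fE.
Qed.

(** A cluster point in [A] of the image filter under [set_val] lifts to the subtype, whose open sets
    are traces of open sets of [T]. *)
Lemma compact_set_type (T : topologicalType) (A : set T) :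
  compact A -> compact [set: A].
Proof.
move=> cA F FF _.
have FA : (set_val @ F) A.
  apply: (@filterS _ F _ setT); last exact: filterT.
  by move=> x _ /=; exact: set_valP.
have [p [Ap clp]] := cA _ (fmap_proper_filter set_val FF) FA.
exists (exist _ p (mem_set Ap)); split => // B W FB [_ [[V oV <-] Vp] VW].
have FB' : (set_val @ F) (set_val @` B).
  by apply: (@filterS _ F _ B) => // x Bx; exists x.
have [_ [[b Bb <-] Vb]] := clp _ V FB' (open_nbhs_nbhs (conj oV Vp)).
by exists b; split => //; exact: VW.
Qed.

Lemma mx_entry_continuous (K : topologicalType) m n i j :
  continuous (fun M : 'M[K]_(m, n) => M i j).
Proof.
move=> M U MU; exists (fun i' j' => if (i' == i) && (j' == j) then U else setT).
  move=> i' j'; case: ifP => [/andP[/eqP -> /eqP ->]|_] //; exact: filterT.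
by move=> N /(_ i j); rewrite !eqxx.
Qed.

Lemma continuous_mx (T K : topologicalType) m n (f : T -> 'M[K]_(m, n)) :
  (forall i j, continuous (fun x => f x i j)) -> continuous f.
Proof.
move=> fc x U [P Pf PU]; 
have : \forall y \near x, forall ij : 'I_m * 'I_n, P ij.1 ij.2 (f y ij.1 ij.2).
  by apply: filter_forall => -[i j]; exact/fc/Pf.
by apply: filterS => y Py; apply: PU => i j; exact: (Py (i, j)).
Qed.

(** The box of row vectors is compact by [rV_compact], and the continuous reshaping [vec_mx] maps it
    onto the box of matrices. *)
Lemma compact_mx_itv (R : realType) m n (a b : R) :
  compact [set M : 'M[R]_(m, n) | forall i j, a <= M i j <= b].
Proof.
have cv : compact [set v : 'rV[R]_(m * n) | forall i, a <= v ord0 i <= b].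
  have := @rV_compact R (m * n)%N (fun=> `[a, b]%classic)
    (fun=> @segment_compact R a b).
  rewrite (_ : mkset _ = [set v : 'rV[R]_(m * n) | forall i, a <= v ord0 i <= b]); first by [].
  by apply/seteqP; split => v vP i; have := vP i; rewrite /= in_itv.
have := continuous_compact (f := @vec_mx R m n) _ cv.
rewrite (_ : vec_mx @` _ = [set M : 'M[R]_(m, n) | forall i j, a <= M i j <= b]).
  apply; apply: continuous_subspaceT; apply: continuous_mx => i j.
  under eq_fun do rewrite mxE.
  exact: mx_entry_continuous.
apply/seteqP; split => [_ [v vP <-] i j|M MP]; first by rewrite mxE.
exists (mxvec M); last exact: mxvecK.
by move=> k; case/mxvec_indexP: k => i j; rewrite mxvecE.
Qed.

(** * Continuity of algebraic and matrix operations *)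

Lemma continuous_comp_fun (T U V : topologicalType) (f : T -> U) (g : U -> V) :
  continuous f -> continuous g -> continuous (fun x => g (f x)).
Proof. by move=> fc gc x; apply: (@continuous_comp _ _ _ f g); [exact: fc|exact: gc]. Qed.

Lemma continuous_mul (T : topologicalType) (K : numFieldType) (f g : T -> K) :
  continuous f -> continuous g -> continuous (fun x => f x * g x).
Proof. by move=> fc gc x; apply: (@cvgM K T); [exact: fc|exact: gc]. Qed.

Lemma continuous_add (T : topologicalType) (K : numFieldType) (f g : T -> K) :
  continuous f -> continuous g -> continuous (fun x => f x + g x).
Proof. by move=> fc gc x; apply: (@cvgD K K T); [exact: fc|exact: gc]. Qed.

Lemma continuous_opp (T : topologicalType) (K : numFieldType) (f : T -> K) :
  continuous f -> continuous (fun x => - f x).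
Proof. by move=> fc x; apply: (@cvgN K K T); exact: fc. Qed.

Lemma mulmx_continuous (T : topologicalType) (K : numFieldType) m n p
    (f : T -> 'M[K]_(m, n)) (g : T -> 'M[K]_(n, p)) :
  continuous f -> continuous g -> continuous (fun x => f x *m g x).
Proof.
move=> fc gc; apply: continuous_mx => i j.
under eq_fun do rewrite mxE.
apply: (@continuous_big K) => [|k _]; first exact: add_continuous.
apply: continuous_mul.
  exact: (continuous_comp_fun fc (@mx_entry_continuous _ _ _ i k)).
exact: (continuous_comp_fun gc (@mx_entry_continuous _ _ _ k j)).
Qed.

Lemma det_continuous (K : numFieldType) n : continuous (@determinant K n).
Proof.
apply: (@continuous_big K) => [|s _]; first exact: add_continuous.
apply: continuous_mul; first exact: cst_continuous.
apply: (@continuous_big K) => [|i _]; first exact: mul_continuous.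
exact: mx_entry_continuous.
Qed.

Lemma trmx_continuous (K : topologicalType) m n : continuous (@trmx K m n).
Proof.
apply: continuous_mx => i j; under eq_fun do rewrite mxE.
exact: mx_entry_continuous.
Qed.

Lemma real_complex_continuous (R : realType) : continuous (fun x : R => x%:C).
Proof.
move=> x; apply/cvgrPdist_lt => -[e e'].
(* A positive complex number is real, so the radius has zero imaginary part and the estimate becomes
   one in [R]. *)
rewrite ltcE /= => /andP[/eqP -> e0].
near=> y; rewrite -raddfB normc_def /= expr0n addr0 sqrtr_sqr ltcR.
near: y; exact: (@cvgr_dist_lt _ R).
Unshelve. all: by end_near. Qed.

Lemma complex_continuous (R : realType) (T : topologicalType) (f g : T -> R) :
  continuous f -> continuous g -> continuous (fun x => f x +i* g x).
Proof.
move=> fc gc.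
rewrite (_ : (fun x => _) = fun x => (f x)%:C + 'i%C * (g x)%:C); last first.
  by apply/funext => x; rewrite [LHS]complexE.
apply: continuous_add.
  exact: continuous_comp_fun fc (@real_complex_continuous R).
apply: continuous_mul; first exact: cst_continuous.
exact: continuous_comp_fun gc (@real_complex_continuous R).
Qed.

Lemma cis_continuous (R : realType) : continuous (@cis R).
Proof. exact: complex_continuous (@continuous_cos R) (@continuous_sin R). Qed.

Lemma diag3_continuous (R : realType) (T : topologicalType) (f g h : T -> R[i]) :
  continuous f -> continuous g -> continuous h ->
  continuous (fun x => diag3 (f x) (g x) (h x)).
Proof.
move=> fc gc hc; apply: continuous_mx => i j.
pose e k := match k with 0%N => f | 1%N => g | _ => h end.
have ec k : continuous (e k).
  by case: k => [|[|k]]; [exact fc|exact gc|exact hc].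
rewrite (_ : (fun x => _) = if i == j then e i else fun=> 0); last first.
  apply/funext => x; rewrite !mxE; case: (eqVneq i j) => [->|//].
  by case: j => -[|[|[|]]].
by case: eqP => _; [exact: ec|exact: cst_continuous].
Qed.

Lemma torus_mx_continuous (R : realType) :
  continuous (fun ab : R * R => torus_mx ab.1 ab.2).
Proof.
have fc : continuous (fun ab : R * R => ab.1) by move=> x; exact: cvg_fst.
have sc : continuous (fun ab : R * R => ab.2) by move=> x; exact: cvg_snd.
have cc := @cis_continuous R.
apply: diag3_continuous.
- exact: continuous_comp_fun fc cc.
- exact: continuous_comp_fun sc cc.
- exact: continuous_comp_fun (continuous_opp (continuous_add fc sc)) cc.
Qed.

(** * Matrices of size 3 *)

(** Indices are written as elements of the ring ['I_3], so that the cyclic shifts [i + 1] and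
    [i + 2%:R] used below can be evaluated by [I3E] in each case. *)
Lemma ord3P (P : 'I_3 -> Prop) : P 0 -> P 1 -> P 2%:R -> forall i, P i.
Proof.
move=> P0 P1 P2 [[|[|[|//]]] lti].
- by rewrite (_ : Ordinal _ = 0) //; exact: val_inj.
- by rewrite (_ : Ordinal _ = 1) //; exact: val_inj.
- by rewrite (_ : Ordinal _ = 2%:R) //; exact: val_inj.
Qed.

Lemma sum3E (V : nmodType) (F : 'I_3 -> V) : \sum_i F i = F 0 + F 1 + F 2%:R.
Proof.
rewrite !big_ord_recl big_ord0 addr0 addrA.
by congr (F _ + F _ + F _); exact: val_inj.
Qed.

Lemma I3_21 : 2%:R + 1 = 0 :> 'I_3. Proof. exact: val_inj. Qed.
Lemma I3_12 : 1 + 2%:R = 0 :> 'I_3. Proof. exact: val_inj. Qed.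
Lemma I3_22 : 2%:R + 2%:R = 1 :> 'I_3. Proof. exact: val_inj. Qed.
Lemma I3_11 : 1 + 1 = 2%:R :> 'I_3. Proof. exact: val_inj. Qed.
Definition I3E := (I3_11, I3_12, I3_21, I3_22, add0r (1 : 'I_3), add0r (2%:R : 'I_3)).

Lemma det2E (K : comNzRingType) (A : 'M[K]_2) :
  \det A = A 0 0 * A 1 1 - A 0 1 * A 1 0.
Proof.
have e0 i : lift (0 : 'I_2) (i : 'I_1) = 1 by rewrite ord1; exact: val_inj.
have e1 i : lift (1 : 'I_2) (i : 'I_1) = 0 by rewrite ord1; exact: val_inj.
rewrite (expand_det_row _ 0) !big_ord_recl big_ord0 e0 /cofactor.
by rewrite !det_mx11 !mxE /= !e0 !e1 /= addr0 !addn0 add0n expr0 expr1; ring.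
Qed.

(* Indices are cyclic (mod 3), which absorbs the sign of the cofactor. *)
Lemma cofactor3E (K : comNzRingType) (A : 'M[K]_3) i j :
  cofactor A i j = A (i + 1) (j + 1) * A (i + 2%:R) (j + 2%:R)
                 - A (i + 1) (j + 2%:R) * A (i + 2%:R) (j + 1).
Proof.
have cofE (i0 j0 k0 k1 l0 l1 : 'I_3) :
    lift i0 (0 : 'I_2) = k0 -> lift i0 (1 : 'I_2) = k1 ->
    lift j0 (0 : 'I_2) = l0 -> lift j0 (1 : 'I_2) = l1 ->
    cofactor A i0 j0 = (-1) ^+ (i0 + j0) * (A k0 l0 * A k1 l1 - A k0 l1 * A k1 l0).
  by move=> <- <- <- <-; rewrite /cofactor det2E !mxE.
have [l00 l01] : lift (0 : 'I_3) (0 : 'I_2) = 1 /\ lift (0 : 'I_3) (1 : 'I_2) = 2%:R.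
  by split; exact: val_inj.
have [l10 l11] : lift (1 : 'I_3) (0 : 'I_2) = 0 /\ lift (1 : 'I_3) (1 : 'I_2) = 2%:R.
  by split; exact: val_inj.
have [l20 l21] : lift (2%:R : 'I_3) (0 : 'I_2) = 0 /\ lift (2%:R : 'I_3) (1 : 'I_2) = 1.
  by split; exact: val_inj.
elim/ord3P: i; elim/ord3P: j; rewrite !I3E.
- by rewrite (cofE _ _ _ _ _ _ l00 l01 l00 l01) /=; ring.
- by rewrite (cofE _ _ _ _ _ _ l00 l01 l10 l11) /=; ring.
- by rewrite (cofE _ _ _ _ _ _ l00 l01 l20 l21) /=; ring.
- by rewrite (cofE _ _ _ _ _ _ l10 l11 l00 l01) /=; ring.
- by rewrite (cofE _ _ _ _ _ _ l10 l11 l10 l11) /=; ring.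
- by rewrite (cofE _ _ _ _ _ _ l10 l11 l20 l21) /=; ring.
- by rewrite (cofE _ _ _ _ _ _ l20 l21 l00 l01) /=; ring.
- by rewrite (cofE _ _ _ _ _ _ l20 l21 l10 l11) /=; ring.
- by rewrite (cofE _ _ _ _ _ _ l20 l21 l20 l21) /=; ring.
Qed.

(** * Real flags as classes of rotations *)

Section SpecialOrthogonal.
Context {R : realType}.
Local Notation V := 'cV[R]_3.

Definition SO3 : set 'M[R]_3 := [set q | q *m q^T = 1%:M /\ \det q = 1].

Lemma SO3M p q : SO3 p -> SO3 q -> SO3 (p *m q).
Proof.
move=> [pO dp] [qO dq]; split; last by rewrite det_mulmx dp dq mulr1.
by rewrite trmx_mul mulmxA -(mulmxA p) qO mulmx1.
Qed.

Lemma SO3_tr q : SO3 q -> SO3 q^T.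
Proof. by move=> [qO dq]; split; [rewrite trmxK; exact: mulmx1C|rewrite det_tr]. Qed.

Lemma Z22_SO3 s : Z22 s -> SO3 s.
Proof.
move=> sZ; split; last by case: sZ.
suff -> : s^T = s by exact: Z22_sqr.
by case: sZ => /diag_mxP[d ->] _ _; exact: tr_diag_mx.
Qed.

Lemma SO3_row q i : SO3 q -> q i 0 ^+ 2 + q i 1 ^+ 2 + q i 2%:R ^+ 2 = 1.
Proof.
move=> [/matrixP/(_ i i)+ _]; rewrite !mxE sum3E !mxE eqxx mulr1n => E.
by rewrite !expr2.
Qed.

Lemma SO3_col q j : SO3 q -> q 0 j ^+ 2 + q 1 j ^+ 2 + q 2%:R j ^+ 2 = 1.
Proof. by move=> /SO3_tr/(@SO3_row _ j); rewrite !mxE. Qed.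

(** The defining equations are closed, and unit rows confine all entries to [[-1, 1]]. *)
Lemma SO3_compact : compact SO3.
Proof.
apply: subclosed_compact (@compact_mx_itv R 3 3 (-1) 1) _.
  rewrite (_ : SO3 = [set q | q *m q^T = 1%:M] `&` [set q | \det q = 1]); last first.
    by [].
  apply: closedI.
    apply: (@preimage_closed _ _ (fun q : 'M[R]_3 => q *m q^T) [set 1%:M]).
      move=> q _; apply: mulmx_continuous; last exact: trmx_continuous.
      by move=> x; exact: cvg_id.
    apply: compact_closed; last exact: compact_set1.
    exact: norm_hausdorff.
  apply: (@preimage_closed _ _ (@determinant R 3) [set 1]).
    by move=> q _; exact: det_continuous.
  exact: closed_eq.
move=> q qS i j; have := SO3_row i qS.
by elim/ord3P: j => E; apply/andP; split; nra.
Qed.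

(** The unit first column gives [m 0 0 ^+ 2 = 1], which exhausts the norm of the first row and kills
    its other entries; the second column and row follow in the same way. *)
Lemma Z22_triangular m : SO3 m -> m 1 0 = 0 -> m 2%:R 0 = 0 -> m 2%:R 1 = 0 -> Z22 m.
Proof.
move=> mS m10 m20 m21.
have c0 := SO3_col 0 mS; have c1 := SO3_col 1 mS.
have r0 := SO3_row 0 mS; have r1 := SO3_row 1 mS; have r2 := SO3_row 2%:R mS.
rewrite m10 m20 in c0; rewrite m21 in c1; rewrite m10 in r1; rewrite m20 m21 in r2.
have m00 : m 0 0 ^+ 2 = 1 by lra.
have m01 : m 0 1 = 0 by apply/eqP; rewrite -sqrf_eq0; apply/eqP; nra.
have m02 : m 0 2%:R = 0 by apply/eqP; rewrite -sqrf_eq0; apply/eqP; nra.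
rewrite m01 in c1.
have m11 : m 1 1 ^+ 2 = 1 by lra.
have m12 : m 1 2%:R = 0 by apply/eqP; rewrite -sqrf_eq0; apply/eqP; nra.
have m22 : m 2%:R 2%:R ^+ 2 = 1 by lra.
split; last by case: mS.
- by apply/is_diag_mxP; elim/ord3P; elim/ord3P.
- have sgn (x : R) : x ^+ 2 = 1 -> x = 1 \/ x = -1.
    by move=> /eqP; rewrite sqrf_eq1 => /orP[] /eqP; [left|right].
  by elim/ord3P; exact: sgn.
Qed.

End SpecialOrthogonal.

(** * Orthonormal frames and the flags they span *)

Section Flags.
Context {R : realType}.
Local Notation V := 'cV[R]_3.
Local Notation SO3 := (@SO3 R).

Lemma frame_free (v : @frameR R) : free [:: (val v).1; (val v).2].
Proof. exact: set_mem (valP v). Qed.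

Lemma frame_fst_neq0 (v : @frameR R) : (val v).1 != 0.
Proof.
by apply: contraTneq (frame_free v) => ->; rewrite free_cons mem0v.
Qed.

(** Freeness of [w] forces [a] and [c] to be nonzero. In the converse the subspaces compared have
    equal dimension, so one inclusion gives equality. *)
Lemma flag_of_frameP (v w : @frameR R) :
  flag_of_frame v = flag_of_frame w <->
  exists a b c, (val w).1 = a *: (val v).1 /\
                (val w).2 = b *: (val v).1 + c *: (val v).2.
Proof.
split=> [vw|[a [b [c [w1 w2]]]]].
  have E1 : <[(val v).1]>%VS = <[(val w).1]>%VS := congr1 (fst \o val) vw.
  have E2 : <<[:: (val v).1; (val v).2]>>%VS = <<[:: (val w).1; (val w).2]>>%VS :=
    congr1 (snd \o val) vw.
  have /vlineP[a w1] : (val w).1 \in <[(val v).1]>%VS by rewrite E1 memv_line.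
  have : (val w).2 \in <<[:: (val v).1; (val v).2]>>%VS.
    by rewrite E2 memv_span // !inE eqxx orbT.
  rewrite span_cons span_seq1 => /memv_addP[_ /vlineP[b ->]] [_ /vlineP[c ->]] w2.
  by exists a, b, c.
apply/val_inj => /=; congr (_, _); apply/esym/eqP; rewrite eqEdim.
  rewrite !dim_vline !frame_fst_neq0 leqnn andbT -memvE w1.
  by rewrite memvZ // memv_line.
rewrite (eqP (frame_free v)) (eqP (frame_free w)) leqnn andbT.
have v1 : (val v).1 \in <<[:: (val v).1; (val v).2]>>%VS.
  by rewrite memv_span // !inE eqxx.
have v2 : (val v).2 \in <<[:: (val v).1; (val v).2]>>%VS.
  by rewrite memv_span // !inE eqxx orbT.
rewrite span_cons span_seq1 subv_add -!memvE w1 w2.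
by rewrite memvD ?memvZ.
Qed.

Lemma SO3_frame (q : SO3) : frameR (col 0 (val q), col 1 (val q)).
Proof.
have [qO _] := SO3_tr (set_valP q); rewrite trmxK in qO.
have qcol j k : ((col j (val q))^T *m col k (val q)) 0 0 = (j == k)%:R.
  by move/matrixP/(_ j k): qO; rewrite !mxE => <-; apply: eq_bigr => i _; rewrite !mxE.
have col_neq0 j : col j (val q) != 0.
  apply/eqP => E; have := qcol j j; rewrite E mulmx0 mxE eqxx.
  by move/eqP; rewrite eq_sym oner_eq0.
rewrite /frameR /= free_cons span_seq1 seq1_free col_neq0 andbT.
(* Pairing a relation [col 0 = k *: col 1] with column 1 gives [k = 0], so column 0 would vanish. *)
apply/vlineP => -[k E]; have := qcol 1 0; rewrite E -scalemxAr mxE qcol eqxx mulr1.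
by move=> /= k0; have := col_neq0 0; rewrite E k0 scale0r eqxx.
Qed.

Definition frame_SO3 (q : SO3) : @frameR R := SigSub (mem_set (SO3_frame q)).

Definition flag_SO3 (q : SO3) : @flagR R := flag_of_frame (frame_SO3 q).

Lemma col_continuous j : continuous (fun M : 'M[R]_3 => col j M).
Proof.
apply: continuous_mx => i k.
rewrite (_ : (fun M => _) = fun M : 'M[R]_3 => M i j).
  exact: mx_entry_continuous.
by apply/funext => M; rewrite mxE.
Qed.

Lemma set_val_continuous (T : topologicalType) (A : set T) :
  continuous (set_val : A -> T).
Proof. exact: initial_continuous. Qed.

Lemma flag_SO3_continuous : continuous flag_SO3.
Proof.
have vc := @set_val_continuous _ SO3.
have fc : continuous frame_SO3.
  have c0 := continuous_comp_fun vc (@col_continuous 0).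
  have c1 := continuous_comp_fun vc (@col_continuous 1).
  apply: continuous_comp_initial => q.
  exact: (cvg_pair (c0 q) (c1 q)).
apply: continuous_comp_fun fc _.
(* Flags carry the quotient topology of [flag_of_frame], whose continuity therefore holds by
   definition. *)
by apply/continuousP => U.
Qed.

Lemma col_mulmx (K : pzSemiRingType) m n p (A : 'M[K]_(m, n)) (B : 'M[K]_(n, p)) j :
  col j (A *m B) = A *m col j B.
Proof. by apply/colP => i; rewrite !mxE; apply: eq_bigr => k _; rewrite mxE. Qed.

Definition mulZ22 (s : @Z22 R) (q : SO3) : SO3 :=
  SigSub (mem_set (SO3M (Z22_SO3 (set_valP s)) (set_valP q))).

Lemma mulZ22_flag (s : @Z22 R) q : Z22_act s (flag_SO3 q) = flag_SO3 (mulZ22 s q).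
Proof.
apply/val_inj; rewrite /= /mx_image limg_line limg_span /= !lfunE /=.
by rewrite !col_mulmx.
Qed.

(** The transition matrix [m], the transpose of [q] times [q'], is a rotation; equal flags make it
    upper triangular, hence a diagonal of signs. Conversely, signs on the right only rescale
    columns. *)
Lemma eq_flag_SO3 q q' :
  flag_SO3 q = flag_SO3 q' <-> exists2 s, Z22 s & val q' = val q *m s.
Proof.
have qS := set_valP q; have [qO _] := SO3_tr qS; rewrite trmxK in qO.
split=> [/flag_of_frameP[a [b [c [/= E0 E1]]]]|[s sZ E]]; last first.
  have [/diag_mxP[d sE] _ _] := sZ.
  have colE j : col j (val q') = d 0 j *: col j (val q).
    by rewrite E sE mul_mx_diag; apply/colP => i; rewrite !mxE mulrC.
  apply/flag_of_frameP; exists (d 0 0), 0, (d 0 1).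
  by rewrite /= scale0r add0r !colE.
pose m := (val q)^T *m val q'.
have mS : SO3 m by apply: SO3M; [exact: SO3_tr|exact: set_valP].
have q'E : val q' = val q *m m by rewrite mulmxA; case: qS => -> _; rewrite mul1mx.
have mcol j : col j m = (val q)^T *m col j (val q') by rewrite col_mulmx.
have ecol j : (val q)^T *m col j (val q) = col j 1%:M by rewrite -col_mulmx qO.
have m0 i : m i 0 = a *+ (i == 0).
  move/colP: (mcol 0) => /(_ i); rewrite E0 -scalemxAr ecol !mxE => ->.
  by rewrite mulr_natr.
have m1 i : m i 1 = b *+ (i == 0) + c *+ (i == 1).
  move/colP: (mcol 1) => /(_ i); rewrite E1 mulmxDr -!scalemxAr !ecol !mxE => ->.
  by rewrite !mulr_natr.
exists m => //; apply: Z22_triangular => //; rewrite ?m0 ?m1 //.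
by rewrite addr0.
Qed.

End Flags.

(** * Gram-Schmidt orthonormalization *)

Section GramSchmidt.
Context {R : realType}.
Local Notation V := 'cV[R]_3.
Local Notation SO3 := (@SO3 R).
Implicit Types u v w : V.

Definition dot u v : R := \sum_i u i 0 * v i 0.

(** The cyclic indices match [cofactor3E]: these are the cofactors of the last column of
    [frame_mx u v]. *)
Definition cross u v : V :=
  \col_i (u (i + 1) 0 * v (i + 2%:R) 0 - v (i + 1) 0 * u (i + 2%:R) 0).

Definition frame_mx u v : 'M[R]_3 := \matrix_(i, j) [:: u; v; cross u v]`_j i 0.

Lemma dotC u v : dot u v = dot v u.
Proof. by apply: eq_bigr => i _; rewrite mulrC. Qed.

(** Lagrange's identity [|u x v|^2 = |u|^2 |v|^2 - (u.v)^2] in coordinates, for an orthonormal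
    pair. *)
Let lagrange (a b c x y z : R) :
  a * a + b * b + c * c = 1 -> x * x + y * y + z * z = 1 ->
  a * x + b * y + c * z = 0 ->
  (b * z - y * c) ^+ 2 + (c * x - z * a) ^+ 2 + (a * y - x * b) ^+ 2 = 1.
Proof.
move=> n1 n2 n12.
transitivity ((a * a + b * b + c * c) * (x * x + y * y + z * z)
  - (a * x + b * y + c * z) ^+ 2); first by ring.
by rewrite n1 n2 n12; ring.
Qed.

Let triple_l (a b c x y z : R) :
  a * (b * z - y * c) + b * (c * x - z * a) + c * (a * y - x * b) = 0.
Proof. ring. Qed.

Let triple_r (a b c x y z : R) :
  x * (b * z - y * c) + y * (c * x - z * a) + z * (a * y - x * b) = 0.
Proof. ring. Qed.

Lemma dot_cross_l u v : dot u (cross u v) = 0.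
Proof. by rewrite /dot sum3E !mxE !I3E; exact: triple_l. Qed.

Lemma dot_cross_r u v : dot v (cross u v) = 0.
Proof. by rewrite /dot sum3E !mxE !I3E; exact: triple_r. Qed.

Lemma dot_cross u v : dot u u = 1 -> dot v v = 1 -> dot u v = 0 ->
  dot (cross u v) (cross u v) = 1.
Proof.
rewrite /dot !sum3E !mxE !I3E -!expr2; rewrite !expr2 => uu vv uv.
by rewrite -!expr2; exact: lagrange.
Qed.

Lemma frame_mx_SO3 u v :
  dot u u = 1 -> dot v v = 1 -> dot u v = 0 -> SO3 (frame_mx u v).
Proof.
move=> uu vv uv; have ww := dot_cross uu vv uv.
have uw := dot_cross_l u v; have vw := dot_cross_r u v; split.
  apply: mulmx1C; apply/matrixP => i j.
  transitivity (dot [:: u; v; cross u v]`_i [:: u; v; cross u v]`_j).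
    by rewrite mxE; apply: eq_bigr => k _; rewrite !mxE.
  rewrite mxE; elim/ord3P: i; elim/ord3P: j => /=;
    by rewrite ?uu ?vv ?ww ?uv ?uw ?vw // dotC ?uv ?uw ?vw.
(* Expanding along the last column pairs [cross u v] with its own entries as cofactors, so the
   determinant is the squared norm [ww]. *)
rewrite (expand_det_col _ 2%:R) -ww; apply: eq_bigr => i _; congr (_ * _).
  by rewrite mxE.
by rewrite cofactor3E !I3E !mxE.
Qed.

Definition normalize u : V := (Num.sqrt (dot u u))^-1 *: u.

Lemma dot_gt0 u : u != 0 -> 0 < dot u u.
Proof.
move=> u0; rewrite lt_def sumr_ge0 ?andbT; last by move=> i _; rewrite -expr2 sqr_ge0.
apply: contra u0; rewrite psumr_eq0; last by move=> i _; rewrite -expr2 sqr_ge0.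
move=> /allP u0; apply/eqP/colP => i; rewrite mxE; apply/eqP.
by have := u0 i (mem_index_enum i); rewrite /= mulf_eq0 orbb.
Qed.

Lemma dotZl a u v : dot (a *: u) v = a * dot u v.
Proof. by rewrite /dot mulr_sumr; apply: eq_bigr => i _; rewrite mxE mulrA. Qed.

Lemma dotZr a u v : dot u (a *: v) = a * dot u v.
Proof. by rewrite /dot mulr_sumr; apply: eq_bigr => i _; rewrite mxE mulrCA. Qed.

Lemma dotBr u v w : dot u (v - w) = dot u v - dot u w.
Proof.
by rewrite /dot -sumrB; apply: eq_bigr => i _; rewrite !mxE mulrBr.
Qed.

Lemma normalize_unit u : u != 0 -> dot (normalize u) (normalize u) = 1.
Proof.
move=> /dot_gt0 u0; rewrite dotZl dotZr mulrA -invfM -expr2 sqr_sqrtr ?ltW //.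
by rewrite mulVf // gt_eqF.
Qed.

Definition orth u v : V := v - dot u v *: u.

Lemma dot_orth u v : dot u u = 1 -> dot u (orth u v) = 0.
Proof. by move=> u1; rewrite dotBr dotZr u1 mulr1 subrr. Qed.

(** The multiple [a] covers the normalized first vector; a vanishing residue would put the second
    vector on the line of the first. *)
Lemma orth_neq0 (x : @frameR R) a : orth (a *: (val x).1) (val x).2 != 0.
Proof.
have := frame_free x; rewrite (perm_free (_ : perm_eq _ [:: (val x).2; (val x).1])).
  rewrite free_cons span_seq1 => /andP[+ _]; apply: contra.
  rewrite subr_eq0 => /eqP ->; rewrite scalerA.
  by rewrite memvZ ?memv_line.
by rewrite (perm_catC [:: _]).
Qed.

Definition gs_fst (x : @frameR R) := normalize (val x).1.
Definition gs_snd (x : @frameR R) := normalize (orth (gs_fst x) (val x).2).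

Lemma gs_mx_SO3 x : SO3 (frame_mx (gs_fst x) (gs_snd x)).
Proof.
have u1 : dot (gs_fst x) (gs_fst x) = 1 by exact/normalize_unit/frame_fst_neq0.
apply: frame_mx_SO3 => //; first exact/normalize_unit/orth_neq0.
by rewrite [LHS]dotZr dot_orth ?mulr0.
Qed.

Definition gram_schmidt x : SO3 := SigSub (mem_set (gs_mx_SO3 x)).

Lemma gram_schmidt_flag x : flag_SO3 (gram_schmidt x) = flag_of_frame x.
Proof.
apply/esym/flag_of_frameP => /=.
have c0 : col 0 (frame_mx (gs_fst x) (gs_snd x)) = gs_fst x.
  by apply/colP => i; rewrite !mxE.
have c1 : col 1 (frame_mx (gs_fst x) (gs_snd x)) = gs_snd x.
  by apply/colP => i; rewrite !mxE.
rewrite c0 c1 /gs_snd /gs_fst /orth /normalize.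
set a := (Num.sqrt _)^-1; set b := (Num.sqrt _)^-1.
set d := dot _ _.
(* Coefficients read off from [b *: (v2 - d *: (a *: v1))]: Gram-Schmidt is a triangular change of
   basis. *)
exists a, (- (b * d * a)), b; split=> //.
by rewrite scalerBr addrC !scalerA scaleNr.
Qed.

Lemma dot_continuous (T : topologicalType) (f g : T -> V) :
  continuous f -> continuous g -> continuous (fun x => dot (f x) (g x)).
Proof.
move=> fc gc; apply: (@continuous_big R) => [|i _]; first exact: add_continuous.
apply: continuous_mul.
  exact: (continuous_comp_fun fc (@mx_entry_continuous _ _ _ i 0)).
exact: (continuous_comp_fun gc (@mx_entry_continuous _ _ _ i 0)).
Qed.

Lemma scale_continuous_fun (T : topologicalType) (k : T -> R) (f : T -> V) :
  continuous k -> continuous f -> continuous (fun x => k x *: f x).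
Proof. by move=> kc fc x; apply: cvgZ; [exact: kc|exact: fc]. Qed.

Lemma normalize_continuous (T : topologicalType) (f : T -> V) :
  (forall x, f x != 0) -> continuous f -> continuous (fun x => normalize (f x)).
Proof.
move=> f0 fc; apply: scale_continuous_fun => //.
have dc := continuous_comp_fun (dot_continuous fc fc) (@sqrt_continuous R).
move=> x; apply: cvgV; last exact: dc.
by rewrite sqrtr_eq0 -ltNge dot_gt0.
Qed.

(** Freeness keeps both norms away from zero, so the inverse norms are continuous; all the rest is
    polynomial. *)
Lemma gram_schmidt_continuous : continuous gram_schmidt.
Proof.
have vc : continuous (set_val : @frameR R -> V * V) by exact: set_val_continuous.
have vc1 : continuous (fun x : @frameR R => (val x).1).
  by apply: continuous_comp_fun vc _ => x; exact: cvg_fst.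
have vc2 : continuous (fun x : @frameR R => (val x).2).
  by apply: continuous_comp_fun vc _ => x; exact: cvg_snd.
have gc1 : continuous gs_fst.
  by apply: normalize_continuous vc1 => x; exact: frame_fst_neq0.
have gc2 : continuous gs_snd.
  apply: normalize_continuous => [x|x]; first exact: orth_neq0.
  have h := scale_continuous_fun (dot_continuous gc1 vc2) gc1.
  exact: (cvgB (vc2 x) (h x)).
have ent i : continuous (fun x => gs_fst x i 0).
  exact: continuous_comp_fun gc1 (@mx_entry_continuous _ _ _ i 0).
have ent2 i : continuous (fun x => gs_snd x i 0).
  exact: continuous_comp_fun gc2 (@mx_entry_continuous _ _ _ i 0).
have ent3 i : continuous (fun x => cross (gs_fst x) (gs_snd x) i 0).
  rewrite (_ : (fun x => _) = fun x => gs_fst x (i + 1) 0 * gs_snd x (i + 2%:R) 0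
      + - (gs_snd x (i + 1) 0 * gs_fst x (i + 2%:R) 0)); last first.
    by apply/funext => x; rewrite mxE.
  apply: continuous_add; last apply: continuous_opp.
  - exact: continuous_mul (ent _) (ent2 _).
  - exact: continuous_mul (ent2 _) (ent _).
apply: continuous_comp_initial.
suff : continuous (fun x => frame_mx (gs_fst x) (gs_snd x)) by [].
apply: continuous_mx => i j.
rewrite (_ : (fun x => _) = fun x =>
    [:: gs_fst x; gs_snd x; cross (gs_fst x) (gs_snd x)]`_j i 0); last first.
  by apply/funext => x; rewrite /= mxE.
by elim/ord3P: j => /=; [exact: ent|exact: ent2|exact: ent3].
Qed.

End GramSchmidt.

(** * The multi-moment map *)

Section ComplexFlags.
Context {R : realType}.
Local Notation C := R[i].
Local Notation cj := (@Num.conj C).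
Local Notation SO3 := (@SO3 R).
Local Notation SU3 := (@SU3 R).
Implicit Types p : 'M[C]_3.

Lemma SU3_adj p : SU3 p -> p^t* = \adj p.
Proof.
move=> [/unitarymxP pU dp].
rewrite -[LHS]mul1mx -(_ : \adj p *m p = 1%:M); last by rewrite mul_adj_mx dp.
by rewrite -mulmxA pU mulmx1.
Qed.

(** The conjugate transpose and the adjugate are both inverse to [p]. This later deduces reality of
    one row from that of the other two. *)
Lemma SU3_conj p i j : SU3 p -> cj (p i j) = cofactor p i j.
Proof. by move=> /SU3_adj/matrixP/(_ j i); rewrite !mxE. Qed.

Lemma SU3_invmx p : SU3 p -> invmx p = p^t*.
Proof.
move=> [/unitarymxP pU _]; have [pu _] := mulmx1_unit pU.
by rewrite -[RHS](mulKmx pu) pU mulmx1.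
Qed.

Lemma diag3_mulE a b c (X : 'M[C]_3) d e f i j :
  (diag3 a b c *m X *m diag3 d e f) i j =
  [:: a; b; c]`_i * X i j * [:: d; e; f]`_j.
Proof. by rewrite /diag3 mul_diag_mx mul_mx_diag !mxE. Qed.

Let w : C := cis (2 * pi / 3).

Let w_conj : cj w = cis (- (2 * pi / 3)). Proof. exact: conj_cis. Qed.

Lemma sin_2pi3_gt0 : 0 < sin (2 * pi / 3) :> R.
Proof. by apply: sin_gt0_pi; have := @pi_gt0 R => pi0; apply/andP; split; lra. Qed.

Lemma cis2pi : cis (2 * pi) = 1 :> C.
Proof. by rewrite /cis mulrC mulr_natr cos2pi sin2pi. Qed.

Let w_conjM : w * cj w = 1.
Proof. by rewrite w_conj -cisD subrr cis0. Qed.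

Let ww : w * w = cj w.
Proof.
rewrite w_conj -[RHS]mul1r -cis2pi -!cisD; congr cis; lra.
Qed.

Let w43 : cis (4 * pi / 3) = cj w.
Proof. by rewrite -ww -cisD; congr cis; lra. Qed.

Let w_sum : w + cj w + 1 = 0.
Proof.
(* [w] is a cube root of unity with positive imaginary part, so [w - 1] can be cancelled in the
   factorization of [w ^+ 3 - 1]. *)
have w1 : w - 1 != 0.
  rewrite subr_eq0; apply/eqP => /(congr1 (@complex.Im R)) /= /eqP.
  by rewrite gt_eqF // sin_2pi3_gt0.
apply: (mulfI w1); rewrite mulr0.
have -> : (w - 1) * (w + cj w + 1) = w * w + w * cj w - cj w - 1 by ring.
by rewrite ww w_conjM; ring.
Qed.

Lemma A0E : A0 = diag3 w (cj w) 1 :> 'M[C]_3.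
Proof. by rewrite /A0 w43. Qed.

Lemma invmx_A0 : invmx A0 = diag3 (cj w) w 1 :> 'M[C]_3.
Proof.
have A0K : A0 *m diag3 (cj w) w 1 = 1%:M :> 'M[C]_3.
  rewrite A0E diag3M w_conjM mulrC w_conjM mulr1 -diag_const_mx; congr diag_mx.
  by apply/rowP; elim/ord3P; rewrite !mxE.
by rewrite -[RHS](mulKmx (@A0_unit R)) A0K mulmx1.
Qed.

Let c : C := (2 / Num.sqrt 3 : R)%:C.
Let D : C := (w - cj w) / 2%:R.

(** Conjugation by [A0] multiplies every entry [(i, i + 1)], with [i] cyclic, by [cj w] and every
    entry [(i + 1, i)] by [w]. Adding one half yields [- D] and [D], because [w + cj w + 1 = 0]. *)
Lemma J0E X i : (J0 X i (i + 1) = - (c * D * X i (i + 1)))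
  /\ (J0 X (i + 1) i = c * D * X (i + 1) i).
Proof.
have J0ij j k : J0 X j k =
    c * ([:: w; cj w; 1]`_j * X j k * [:: cj w; w; 1]`_k + 2%:R^-1 * X j k).
  rewrite /J0 invmx_A0 A0E mxE; congr (_ * _); rewrite mxE; congr (_ + _).
    exact: diag3_mulE.
  by rewrite mxE.
have two0 : 2%:R != 0 :> C by rewrite pnatr_eq0.
have ww' : cj w * cj w = w by rewrite -{1}ww -mulrA w_conjM mulr1.
have D1 : D = w + 2%:R^-1.
  apply: (mulIf two0); rewrite mulfVK // mulrDl mulVf //; apply/eqP.
  by rewrite -subr_eq0 -oppr_eq0 -(rwP eqP) -w_sum; ring.
have D2 : - D = cj w + 2%:R^-1.
  apply: (mulIf two0); rewrite mulNr mulfVK // mulrDl mulVf //; apply/eqP.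
  by rewrite -subr_eq0 -oppr_eq0 -(rwP eqP) -w_sum; ring.
have -> : - (c * D * X i (i + 1)) = c * (- D) * X i (i + 1) by ring.
rewrite !J0ij D2 D1.
elim/ord3P: i; rewrite !I3E /=; split; rewrite ?mul1r ?mulr1.
all: rewrite -[RHS]mulrA; congr (_ * _); rewrite [RHS]mulrDl; congr (_ + _).
- by rewrite mulrAC ww.
- by rewrite mulrAC ww'.
- by rewrite mulrC.
- by rewrite mulrC.
Qed.

(* The factor [k] is in fact 1. *)
Lemma J0_offdiag : exists2 k : R, k != 0 & forall X i,
  (J0 X i (i + 1) = - ((0 +i* k) * X i (i + 1))) /\
  (J0 X (i + 1) i = (0 +i* k) * X (i + 1) i).
Proof.
exists (2 / Num.sqrt 3 * sin (2 * pi / 3)).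
  rewrite mulf_neq0 ?gt_eqF ?sin_2pi3_gt0 // divr_gt0 // sqrtr_gt0; lra.
suff <- : c * D = 0 +i* (2 / Num.sqrt 3 * sin (2 * pi / 3)) by exact: J0E.
have two0 : 2%:R != 0 :> C by rewrite pnatr_eq0.
apply: (mulIf two0); rewrite -(mulrA c D) /D mulfVK // mulr_natr mulr2n.
by apply/eqP; rewrite eq_complex /=; apply/andP; split; apply/eqP; ring.
Qed.

(** Modulo 3, the six off-diagonal positions are exactly the pairs [(i, i + 1)] and [(i + 1, i)]. *)
Lemma sum_offdiag (F : 'I_3 -> 'I_3 -> C) :
  \sum_i \sum_k F k i = \sum_i F i i + \sum_i (F i (i + 1) + F (i + 1) i).
Proof. by rewrite !sum3E !I3E; ring. Qed.

Lemma trace_adj_mul (A B : 'M[C]_3) :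
  \tr (A^t* *m B) = \sum_i \sum_k cj (A k i) * B k i.
Proof.
apply: eq_bigr => i _; rewrite mxE; apply: eq_bigr => k _.
by rewrite !mxE.
Qed.

(** The minus sign comes from the opposite imaginary factors of [J0] on the two kinds of
    off-diagonal entries; the constant absorbs the factor one half of [g0]. *)
Lemma sigma0_m_proj : exists2 k : R, k != 0 & forall X Y,
  sigma0 (m_proj X) (m_proj Y) = complex.Re ((0 +i* k) *
    \sum_i (cj (X i (i + 1)) * Y i (i + 1) - cj (X (i + 1) i) * Y (i + 1) i)).
Proof.
have [k k0 JE] := J0_offdiag; exists (2^-1 * k); first by rewrite mulf_neq0.
move=> X Y; rewrite /sigma0 /g0; congr complex.Re.
have nd (i : 'I_3) : (i == i + 1) = false by elim/ord3P: i.
have nd' (i : 'I_3) : (i + 1 == i) = false by elim/ord3P: i.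
rewrite trace_adj_mul sum_offdiag big1 => [|i _]; last by rewrite [m_proj Y i i]mxE eqxx mulr0.
rewrite add0r !mulr_sumr; apply: eq_bigr => i _.
have [J1 J2] := JE (m_proj X) i.
have -> : 0 +i* (2^-1 * k) = 2^-1 * (0 +i* k) :> C.
  apply: (@mulfI _ (2%:R : C)); first by rewrite pnatr_eq0.
  rewrite mulrA divff ?pnatr_eq0 // mul1r mulr_natl mulr2n.
  by apply/eqP; rewrite eq_complex /= addr0 eqxx /=; apply/eqP; field.
have kC : cj (0 +i* k) = - (0 +i* k).
  by apply/eqP; rewrite eq_complex /= oppr0 !eqxx.
move: (0 +i* k) kC J1 J2 => K kC -> ->.
by rewrite !mxE !nd !nd' rmorphN !rmorphM /= kC; ring.
Qed.

End ComplexFlags.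

(** * Explicit form of the multi-moment map on [SU3] *)

Section MultiMoment.
Context {R : realType}.
Local Notation C := R[i].
Local Notation cj := (@Num.conj C).
Local Notation iC := (@Num.imaginary C).
Local Notation SU3 := (@SU3 R).
Implicit Types p : 'M[C]_3.

(** The name counts rows from 1, the indices from 0. Orthogonality of these two rows makes the three
    products sum to zero. *)
Definition prod23 p i : C := p 1 i * cj (p 2%:R i).

Lemma SU3_col_orth p i j : SU3 p -> i != j ->
  cj (p 0 i) * p 0 j + cj (p 1 i) * p 1 j + cj (p 2%:R i) * p 2%:R j = 0.
Proof.
move=> [/unitarymxP/mulmx1C/matrixP/(_ i j) + _] ij.
by rewrite !mxE sum3E !mxE (negPf ij).
Qed.

Lemma SU3_row_orth p i j : SU3 p -> i != j ->
  p i 0 * cj (p j 0) + p i 1 * cj (p j 1) + p i 2%:R * cj (p j 2%:R) = 0.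
Proof.
move=> [/unitarymxP/matrixP/(_ i j) + _] ij.
by rewrite !mxE sum3E !mxE (negPf ij).
Qed.

Lemma conj_diagE p a b c i j :
  (p^t* *m diag3 a b c *m p) i j =
  cj (p 0 i) * a * p 0 j + cj (p 1 i) * b * p 1 j + cj (p 2%:R i) * c * p 2%:R j.
Proof. by rewrite /diag3 mul_mx_diag mxE sum3E !mxE. Qed.

(** [U0] is [- iC] times the identity plus [3 iC] at the middle diagonal place. The scalar part
    contributes nothing off the diagonal, the columns of [p] being orthogonal; [V0] is treated alike
    with the last place. *)
Lemma conj_U0E p i j : SU3 p -> i != j ->
  (invmx p *m U0 *m p) i j = 3%:R * iC * cj (p 1 i) * p 1 j.
Proof.
move=> pS ij; rewrite SU3_invmx // conj_diagE.
have := SU3_col_orth pS ij.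
move: (cj (p 0 i)) (p 0 j) (cj (p 1 i)) (p 1 j) (cj (p 2%:R i)) (p 2%:R j).
move=> a0 b0 a1 b1 a2 b2 E; rewrite -[RHS]subr0 -[X in _ - X](mulr0 iC) -E; ring.
Qed.

Lemma conj_V0E p i j : SU3 p -> i != j ->
  (invmx p *m V0 *m p) i j = 3%:R * iC * cj (p 2%:R i) * p 2%:R j.
Proof.
move=> pS ij; rewrite SU3_invmx // conj_diagE.
have := SU3_col_orth pS ij.
move: (cj (p 0 i)) (p 0 j) (cj (p 1 i)) (p 1 j) (cj (p 2%:R i)) (p 2%:R j).
move=> a0 b0 a1 b1 a2 b2 E; rewrite -[RHS]subr0 -[X in _ - X](mulr0 iC) -E; ring.
Qed.

Lemma Im_mul_conj (x y : C) : complex.Im (x * cj y) =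
  complex.Im x * complex.Re y - complex.Re x * complex.Im y.
Proof. by case: x y => [a b] [u v] /=; ring. Qed.

(** The [z i] are the sides of a closed triangle, and each of the three values is, up to a common
    sign, twice its oriented area. *)
Lemma Im_cyclic (z : 'I_3 -> C) i : z 0 + z 1 + z 2%:R = 0 ->
  complex.Im (z i * cj (z (i + 1))) = complex.Im (z 0 * cj (z 1)).
Proof.
move=> zsum; have z0E : z 0 = - z 1 - z 2%:R.
  by apply/eqP; rewrite -subr_eq0 opprD !opprK addrA; apply/eqP.
rewrite !Im_mul_conj; elim/ord3P: i; rewrite ?I3E // z0E;
  by case: (z 1) (z 2%:R) => [a b] [u v] /=; ring.
Qed.

Lemma subr_conj (z : C) : z - cj z = (0 +i* complex.Im z) *+ 2.
Proof.
by case: z => a b; apply/eqP; rewrite mulr2n eq_complex /= subrr addr0 opprK !eqxx.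
Qed.

Lemma nu_mx_SU3 : exists2 k : R, k != 0 & forall p, SU3 p ->
  nu_mx p = k * complex.Im (prod23 p 0 * cj (prod23 p 1)).
Proof.
(* 54 is the product of 3 equal cyclic terms, the 9 coming from the factors 3 of [U0] and [V0], and
   the 2 of [z - cj z]; the minus sign is the square of the imaginary unit. *)
have [k k0 sE] := @sigma0_m_proj R; exists (- k *+ 54).
  by rewrite mulrn_eq0 oppr_eq0.
move=> p pS; rewrite /nu_mx sE.
have := conj_V0E pS; have := conj_U0E pS.
generalize (invmx p *m U0 *m p) (invmx p *m V0 *m p) => X Y XE YE.
have z0 : prod23 p 0 + prod23 p 1 + prod23 p 2%:R = 0 by exact: SU3_row_orth.
have ij (i : 'I_3) : i != i + 1 by elim/ord3P: i.
have ji (i : 'I_3) : i + 1 != i by rewrite eq_sym.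
have i2 x y u v : 3%:R * - iC * x * y * (3%:R * iC * u * v) = (x * u * (y * v)) *+ 9.
  transitivity (- (iC ^+ 2) * (x * u * (y * v)) *+ 9); first by ring.
  by rewrite sqrCi opprK mul1r.
rewrite (eq_bigr (fun=> (0 +i* complex.Im (prod23 p 0 * cj (prod23 p 1))) *+ 18)); last first.
  move=> i _; rewrite !XE // !YE // -(@Im_cyclic (prod23 p) i z0).
  rewrite !rmorphM /= !conjCK conjC_nat conjCi !i2 -mulrnBl.
  rewrite (_ : 18 = 2 * 9)%N // mulrnA -subr_conj; congr (_ *+ _).
  rewrite /prod23 !rmorphM /= !conjCK.
  move: (p 1 i) (p 1 (i + 1)) (p 2%:R i) (p 2%:R (i + 1)) => a b c d.
  by rewrite [b * _ * _]mulrC.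
rewrite sumr_const card_ord -mulrnA mulrnAr.
have -> t : (0 +i* k) * (0 +i* t) = (- (k * t))%:C.
  by apply/eqP; rewrite eq_complex /= !mul0r !mulr0 addr0 sub0r !eqxx.
by rewrite -raddfMn /= -mulNr mulrnAl.
Qed.

Lemma nu_mx_SU3_eq0 p : SU3 p ->
  nu_mx p = 0 <-> complex.Im (prod23 p 0 * cj (prod23 p 1)) = 0.
Proof.
have [k k0 nuE] := nu_mx_SU3; move=> pS; rewrite nuE //.
split=> [/eqP|->]; last exact: mulr0.
by rewrite mulf_eq0 (negPf k0) => /eqP.
Qed.

End MultiMoment.

(** * Rephasing the zeros of the multi-moment map *)

Section Rephasing.
Context {R : realType}.
Local Notation C := R[i].
Local Notation cj := (@Num.conj C).
Local Notation SU3 := (@SU3 R).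
Local Notation SO3 := (@SO3 R).
Implicit Types (p : 'M[C]_3) (q : 'M[R]_3).

(** [acos] gives the angle up to sign, and the sign of [y] decides. The bound on the angle later
    presents the torus as the image of a compact square. *)
Lemma unit_angle (x y : R) : x ^+ 2 + y ^+ 2 = 1 ->
  exists2 a, -pi <= a <= pi & cis a = x +i* y.
Proof.
move=> xy; have x1 : -1 <= x <= 1 by apply/andP; split; nra.
have sE : sin (acos x) = `|y| by rewrite sin_acos // -xy addrAC subrr add0r sqrtr_sqr.
have cE : cos (acos x) = x by rewrite acosK.
have a0 := acos_ge0 x1; have api := acos_lepi x1.
have [y0|y0] := leP 0 y.
  exists (acos x); last by rewrite /cis sE cE ger0_norm.
  by rewrite api andbT; lra.
exists (- acos x); last by rewrite /cis cosN sinN sE cE ltr0_norm // opprK.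
by apply/andP; split; lra.
Qed.

Lemma polar (z : C) : exists (r a : R), z = r%:C * cis a.
Proof.
case: z => x y; set s := x ^+ 2 + y ^+ 2.
have s0 : 0 <= s by rewrite addr_ge0 ?sqr_ge0.
have [s1|s1] := eqVneq s 0.
  exists 0, 0; rewrite mul0r; move/eqP: s1.
  by rewrite paddr_eq0 ?sqr_ge0 // !sqrf_eq0 => /andP[/eqP -> /eqP ->].
set r := Num.sqrt s.
have r0 : r != 0 by rewrite gt_eqF // sqrtr_gt0 lt_def s1.
have [|a _ aE] := @unit_angle (x / r) (y / r).
  by rewrite !exprMn -mulrDl exprVn sqr_sqrtr // divff.
exists r, a; rewrite aE; apply/eqP; rewrite eq_complex /= !mul0r subr0 addr0.
by rewrite !(mulrC r) !divfK ?eqxx.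
Qed.

Lemma cisNK (a : R) : cis a * cis (- a) = 1 :> C.
Proof. by rewrite -cisD subrr cis0. Qed.

Lemma cis_neq0 (a : R) : cis a != 0 :> C.
Proof. by apply: contra_eq_neq (cisNK a) => ->; rewrite mul0r eq_sym oner_eq0. Qed.

Lemma real_complex_real (k : R) : k%:C \is Num.real.
Proof. by apply/complex_realP; exists k. Qed.

(** For [x = r cis a] and [y = s cis b] the hypothesis says [r s sin (b - a) = 0], so [y] lies on
    the real line through [cis a] when [x] is nonzero. The factors may have either sign. *)
Lemma collinear_pair (x y : C) : complex.Im (x * cj y) = 0 ->
  exists a r s, x = r%:C * cis a /\ y = s%:C * cis a.
Proof.
have [r [a xE]] := polar x; have [s [b yE]] := polar y.
have [->|x0] := eqVneq x 0.
  by move=> _; exists b, 0, s; rewrite mul0r.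
have r0 : r != 0 by apply: contra_neq x0 => r0; rewrite xE r0 mul0r.
move=> xy; exists a, r, (s * cos (b - a)); split=> //.
have s0 : s * sin (b - a) = 0.
  apply: (mulfI r0); rewrite mulr0 -[RHS]oppr0 -xy xE yE sinB.
  by rewrite Im_mul_conj /=; ring.
rewrite yE -[b in LHS](subrK a) cisD mulrA; congr (_ * _).
by apply/eqP; rewrite eq_complex /= !mul0r subr0 addr0 s0 !eqxx.
Qed.

Lemma collinear_triple (z : 'I_3 -> C) :
  z 0 + z 1 + z 2%:R = 0 -> complex.Im (z 0 * cj (z 1)) = 0 ->
  exists a, forall i, exists r : R, z i = r%:C * cis a.
Proof.
move=> z0 /collinear_pair[a [r [s [z0E z1E]]]]; exists a.
elim/ord3P; [by exists r|by exists s|exists (- r - s)].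
apply/eqP; rewrite -subr_eq0 -z0 z0E z1E rmorphB rmorphN /=; apply/eqP; ring.
Qed.

(** The pair consists of the entries of rows 1 and 2 in one column. The phase [b] makes [y] real;
    the phase of [x * cj y] then forces the phase needed by [x], with the same [a] for all
    columns. *)
Lemma rephase_column (x y : C) (a r : R) : x * cj y = r%:C * cis a ->
  exists b, x * cis (b - a) \is Num.real /\ y * cis b \is Num.real.
Proof.
have [y0|y0] := eqVneq y 0.
  (* For [y = 0] the relation does not determine the phase of [x], so [b] is read off from [x]
     itself. *)
  move=> _; have [s [c xE]] := polar x; exists (a - c).
  rewrite xE y0 mul0r real0 -mulrA -cisD addrAC subrr add0r subrr cis0 mulr1.
  by rewrite real_complex_real.
have [s [c yE]] := polar y => xy; exists (- c).
have s0 : s != 0 by apply: contra_neq y0 => s0; rewrite yE s0 mul0r.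
rewrite [in y * _]yE -mulrA cisNK mulr1 real_complex_real; split=> //.
suff -> : x * cis (- c - a) = (r / s)%:C by exact: real_complex_real.
have sC0 : s%:C != 0 :> C by rewrite (inj_eq (@complexI R)).
apply: (mulfI sC0); rewrite -rmorphM (_ : s * (r / s) = r); last by rewrite mulrC divfK.
rewrite -[RHS]mulr1 -(cisNK a) [RHS]mulrA -xy yE rmorphM /= conj_Creal ?real_complex_real //.
by rewrite conj_cis cisD; ring.
Qed.

Definition torus_angle (a b : R) : 'I_3 -> R := fun i => [:: a; b; - (a + b)]`_i.

Lemma torus_mulE p (a b c d : R) i j :
  (torus_mx a b *m p *m torus_mx c d) i j =
  cis (torus_angle a b i) * p i j * cis (torus_angle c d j).
Proof.
rewrite diag3_mulE; congr (_ * _ * _).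
  by elim/ord3P: i.
by elim/ord3P: j.
Qed.

Definition complexify q : 'M[C]_3 := map_mx (real_complex R) q.

Lemma SU3_real p : SU3 p -> (forall i j, p i j \is Num.real) ->
  exists2 q, SO3 q & p = complexify q.
Proof.
move=> [/unitarymxP pU dp] preal; exists (map_mx (@complex.Re R) p); last first.
  by apply/matrixP => i j; rewrite !mxE RRe_real.
have pE : p = complexify (map_mx (@complex.Re R) p).
  by apply/matrixP => i j; rewrite !mxE RRe_real.
split; last first.
  by apply: (@complexI R); rewrite -det_map_mx -/(complexify _) -pE.
apply: (@map_mx_inj _ _ (real_complex R)). 
rewrite map_mxM map_mx1 -/(complexify _) -pE -[RHS]pU; congr (_ *m _).
apply/matrixP => i j; rewrite !mxE.
exact: etrans (RRe_real (preal j i)) (esym (conj_Creal (preal j i))).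
Qed.

Lemma complexify_SU3 q : SO3 q -> SU3 (complexify q).
Proof.
move=> [qO dq]; split; last by rewrite det_map_mx dq.
apply/unitarymxP.
rewrite (_ : (complexify q)^t* = complexify q^T) -?map_mxM ?qO ?map_mx1 //.
by apply/matrixP => i j; rewrite !mxE conj_Creal // real_complex_real.
Qed.

Lemma torus_SU3_mx (a b : R) : SU3 (torus_mx a b).
Proof. exact: T2_SU3 (ex_intro _ a (ex_intro _ b erefl)). Qed.

Lemma rephase_real p : SU3 p -> nu_mx p = 0 ->
  exists a b c d, exists2 q, SO3 q &
    torus_mx a b *m p *m torus_mx c d = complexify q.
Proof.
move=> pS /(nu_mx_SU3_eq0 pS).
have p_orth : prod23 p 0 + prod23 p 1 + prod23 p 2%:R = 0 by exact: SU3_row_orth.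
move=> /(collinear_triple p_orth)[a zE].
have /choice[b bP] : forall j, exists b, p 1 j * cis (b - a) \is Num.real /\
    p 2%:R j * cis b \is Num.real.
  by move=> j; have [r /rephase_column] := zE j.
pose B := b 0 + b 1 + b 2%:R.
(* Up to the shift by [B / 3], the row phases are [a - B], [- a], [0] and the column phases are
   [b j]. The shifts cancel in the product and make the phases of each torus factor sum to zero. *)
exists (a - B + B / 3), (- a + B / 3), (b 0 - B / 3), (b 1 - B / 3).
set m := (_ *m _).
have mS : SU3 m := SU3M (SU3M (torus_SU3_mx _ _) pS) (torus_SU3_mx _ _).
have [] := SU3_real mS; last by move=> q qS mE; exists q.
have angE j : torus_angle (b 0 - B / 3) (b 1 - B / 3) j = b j - B / 3.
  by elim/ord3P: j; rewrite /torus_angle //= /B; field.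
have m1 j : m 1 j \is Num.real.
  rewrite torus_mulE angE /torus_angle /= mulrAC -cisD mulrC.
  rewrite (_ : - a + B / 3 + (b j - B / 3) = b j - a); last by ring.
  exact: (bP j).1.
have m2 j : m 2%:R j \is Num.real.
  rewrite torus_mulE angE /torus_angle /= mulrAC -cisD mulrC.
  rewrite (_ : - (a - B + B / 3 + (- a + B / 3)) + (b j - B / 3) = b j); last by field.
  exact: (bP j).2.
(* The entries of row 0 are conjugates of cofactors formed from the two real rows. *)
have m0 j : m 0 j \is Num.real.
  rewrite -[m 0 j]conjCK (SU3_conj 0 j mS) cofactor3E !I3E.
  by rewrite conj_Creal ?rpredB ?rpredM.
by elim/ord3P.
Qed.

Lemma nu_mx_eq0_torus p : SU3 p -> nu_mx p = 0 ->
  exists2 q, SO3 q & exists a b c d,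
    p = torus_mx a b *m complexify q *m torus_mx c d.
Proof.
move=> pS /(rephase_real pS)[a [b [c [d [q qS E]]]]]; exists q => //.
exists (- a), (- b), (- c), (- d); rewrite -E !mulmxA torus_mxM !addNr torus_mx0.
by rewrite mul1mx -mulmxA torus_mxV mulmx1.
Qed.

Lemma nu_mx_complexify q : SO3 q -> nu_mx (complexify q) = 0.
Proof.
move=> /complexify_SU3/nu_mx_SU3_eq0 ->.
by rewrite Im_mul_conj /prod23 !mxE /=; ring.
Qed.

(** * Torus phases and signs *)

Lemma Z22_torus s : Z22 s -> exists a b : R, complexify s = torus_mx a b.
Proof.
move=> [/diag_mxP[d ->] s1 ds].
have d1 i : d 0 i = 1 \/ d 0 i = -1.
  by have := s1 i; rewrite !mxE eqxx mulr1n.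
have dd : d 0 0 * d 0 1 * d 0 2%:R = 1.
  rewrite -ds det_diag !big_ord_recl big_ord0 mulr1 mulrA.
  by congr (d _ _ * d _ _ * d _ _); exact: val_inj.
have ang (x : R) : x = 1 \/ x = -1 -> exists a, cis a = x%:C.
  move=> [->|->]; first by exists 0; rewrite cis0.
  by exists pi; rewrite /cis cospi sinpi.
have [a aE] := ang _ (d1 0); have [b bE] := ang _ (d1 1); exists a, b.
rewrite /complexify map_diag_mx /torus_mx /diag3; congr diag_mx; apply/rowP.
elim/ord3P; rewrite !mxE /= ?aE ?bE //.
(* The third phase is the conjugate of the product of the first two signs, which equals the third
   sign because the determinant is 1. *)
rewrite -conj_cis cisD aE bE -rmorphM conj_Creal ?real_complex_real //.
congr (_ %:C); move: dd; case: (d1 0) => ->; case: (d1 1) => ->; lra.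
Qed.

(* An odd function, so that two phases whose ratio is +-1 have signs of the same
   ratio. *)
Definition phase_sign (z : C) : R :=
  if (0 < complex.Re z) || ((complex.Re z == 0) && (0 < complex.Im z)) then 1 else -1.

Lemma phase_signN z : z != 0 -> phase_sign (- z) = - phase_sign z.
Proof.
case: z => x y; rewrite eq_complex /= /phase_sign /= oppr_gt0 oppr_eq0 oppr_gt0.
case: (ltgtP x 0) => [_|_|_] /=; rewrite ?opprK //.
by case: (ltgtP y 0) => //= _; rewrite ?opprK.
Qed.

Lemma phase_sign_sqr z : phase_sign z * phase_sign z = 1.
Proof. by rewrite /phase_sign; case: ifP => _; rewrite ?mulrNN mulr1. Qed.

(** If [x] is nonzero, [cis (a + b)] is real, hence a sign, and [cis (- b)] is that sign times
    [cis a]; oddness of [phase_sign] transfers the relation. If [x = 0], then [y = 0]. *)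
Lemma phase_sign_mul (a b x y : R) : cis a * x%:C * cis b = y%:C ->
  y = phase_sign (cis a) * x * phase_sign (cis (- b)).
Proof.
have [->|x0] := eqVneq x 0.
  by rewrite !mulr0 !mul0r => /complexI ->.
move=> E.
have abE : cis (a + b) = (y / x)%:C.
  have xC0 : x%:C != 0 :> C by rewrite (inj_eq (@complexI R)).
  apply: (mulfI xC0); rewrite -rmorphM (_ : x * (y / x) = y); last by rewrite mulrC divfK.
  by rewrite cisD mulrCA mulrA; exact: E.
have sin0 : sin (a + b) = 0 by have := congr1 (@complex.Im R) abE.
have cosE : cos (a + b) = y / x by have := congr1 (@complex.Re R) abE.
have yE : y = cos (a + b) * x by rewrite cosE divfK.
have bE : cis (- b) = cis a * (cos (a + b))%:C.
  have -> : (cos (a + b))%:C = cis (- (a + b)) by rewrite /cis sinN cosN sin0 oppr0.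
  by rewrite -cisD opprD addrA subrr add0r.
have /eqP := cos2Dsin2 (a + b); rewrite sin0 expr0n addr0 sqrf_eq1 bE yE.
move=> /orP[] /eqP ->.
  by rewrite mulr1 mul1r mulrAC phase_sign_sqr mul1r.
rewrite rmorphN mulrN1 mulN1r phase_signN ?cis_neq0 // mulrN mulrAC.
by rewrite phase_sign_sqr mul1r.
Qed.

Lemma sign_det (s : 'I_3 -> R) : \det (diag_mx (\row_i s i)) = s 0 * s 1 * s 2%:R.
Proof.
rewrite det_diag; under eq_bigr do rewrite mxE.
rewrite !big_ord_recl big_ord0 mulr1 mulrA.
by congr (s _ * s _ * s _); exact: val_inj.
Qed.

Lemma sign_diag_Z22 (s : 'I_3 -> R) :
  (forall i, s i * s i = 1) -> s 0 * s 1 * s 2%:R = 1 -> Z22 (diag_mx (\row_i s i)).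
Proof.
move=> s2 s1; split; first exact: diag_mx_is_diag.
  move=> i; rewrite !mxE eqxx mulr1n.
  by have /eqP := s2 i; rewrite -expr2 sqrf_eq1 => /orP[] /eqP; [left|right].
by rewrite sign_det.
Qed.

Lemma diag_mulE (s t : 'I_3 -> R) q i j :
  (diag_mx (\row_k s k) *m q *m diag_mx (\row_k t k)) i j = s i * q i j * t j.
Proof. by rewrite mul_mx_diag mul_diag_mx !mxE. Qed.

(** [phase_sign] replaces each row phase and each column phase separately, so one choice of signs
    serves all entries at once. Only the determinants of the two sign matrices remain to be
    corrected. *)
Lemma torus_orbit_real q q' (a b c d : R) : SO3 q -> SO3 q' ->
  torus_mx a b *m complexify q *m torus_mx c d = complexify q' ->
  exists2 s, Z22 s & exists2 t, Z22 t & q' = s *m q *m t.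
Proof.
move=> [_ dq] [_ dq'] E.
pose s i := phase_sign (cis (torus_angle a b i)).
pose t j := phase_sign (cis (- torus_angle c d j)).
have qE i j : q' i j = s i * q i j * t j.
  apply: phase_sign_mul; move/matrixP/(_ i j): E.
  by rewrite torus_mulE !mxE.
have s2 i : s i * s i = 1 by exact: phase_sign_sqr.
have t2 i : t i * t i = 1 by exact: phase_sign_sqr.
set S := s 0 * s 1 * s 2%:R; set T := t 0 * t 1 * t 2%:R.
have S2 : S * S = 1.
  transitivity ((s 0 * s 0) * (s 1 * s 1) * (s 2%:R * s 2%:R)); first by rewrite /S; ring.
  by rewrite !s2 !mulr1.
have ST : S = T.
  have ST1 : S * T = 1.
    rewrite -dq' (_ : q' = diag_mx (\row_k s k) *m q *m diag_mx (\row_k t k)).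
      by rewrite !det_mulmx !sign_det dq mulr1.
    by apply/matrixP => i j; rewrite diag_mulE qE.
  by rewrite -[RHS]mul1r -S2 -mulrA ST1 mulr1.
(* Both determinants equal [S]. Multiplying both matrices by [S] leaves their joint action
   unchanged, as [S * S = 1], and in dimension 3 turns each determinant into the fourth power of
   [S]. *)
exists (diag_mx (\row_i (S * s i))).
  apply: sign_diag_Z22 => [i|]; first by rewrite mulrACA S2 s2 mulr1.
  by rewrite -/S; transitivity (S * S * (S * S)); [rewrite /S; ring|rewrite S2 mulr1].
exists (diag_mx (\row_i (S * t i))).
  apply: sign_diag_Z22 => [i|]; first by rewrite mulrACA S2 t2 mulr1.
  transitivity (S * S * (S * T)); [rewrite /T; ring|by rewrite -ST S2 mulr1].
apply/matrixP => i j; rewrite diag_mulE qE.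
by transitivity (S * S * (s i * q i j * t j)); [rewrite S2 mul1r|ring].
Qed.

End Rephasing.

(** * The two orbit spaces as quotients of SO(3) *)

Section Identification.
Context {R : realType}.
Local Notation C := R[i].
Local Notation SU3 := (@SU3 R).
Local Notation SO3 := (@SO3 R).
Local Notation nu_zero := (@nu_zero R).

Lemma open_orbit_space (G : Type) (X : topologicalType) (act : G -> X -> X)
    (tg : transformation_group act) (U : set (orbit_space tg)) :
  open U <-> open (\pi_(orbit_space tg) @^-1` U).
Proof. by []. Qed.

Definition double_Z22 (q q' : 'M[R]_3) : Prop :=
  exists2 s, Z22 s & exists2 t, Z22 t & q' = s *m q *m t.

(** * The quotient map onto the orbits of real flags *)

Definition flagR_class (q : SO3) : flagR_orbits R :=
  \pi_(orbit_space (@Z22_act_tg R)) (flag_SO3 q).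

(** Left signs come from the group action, right signs from the choice of an orthonormal frame of
    the flag. *)
Lemma eq_flagR_class q q' :
  flagR_class q = flagR_class q' <-> double_Z22 (val q) (val q').
Proof.
split=> [/eq_orbit[s]|[s sZ [t tZ qE]]].
  rewrite mulZ22_flag => /esym/eq_flag_SO3[t tZ qE].
  by exists (val s); [exact: set_valP|exists t].
apply/eq_orbit; exists (SigSub (mem_set sZ)); rewrite mulZ22_flag; apply/esym.
by apply/eq_flag_SO3; exists t.
Qed.

Lemma flagR_class_surj x : exists q, flagR_class q = x.
Proof.
have [v vE] := flag_of_frame_surj (repr x).
by exists (gram_schmidt v); rewrite /flagR_class gram_schmidt_flag vE reprK.
Qed.

Lemma flagR_class_quotient (U : set (flagR_orbits R)) :
  open (flagR_class @^-1` U) <-> open U.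
Proof.
split=> [oU|/open_orbit_space oU].
  apply/open_orbit_space; rewrite /open /= /flagR_open.
  (* Openness of [U] is tested on frames, and [gram_schmidt] lifts frames to [SO3] over the same
     flag. *)
  have /continuousP/(_ _ oU) := @gram_schmidt_continuous R.
  rewrite /flagR_class; congr open; apply/seteqP; split=> v /=;
    by rewrite gram_schmidt_flag.
by have /continuousP/(_ _ oU) := @flag_SO3_continuous R.
Qed.

(** * The quotient map onto the torus orbits of the zero level *)

Definition SO3_SU3 (q : SO3) : SU3 := SigSub (mem_set (complexify_SU3 (set_valP q))).

Local Notation coset p := (\pi_(orbit_space (@rtorus_tg R)) p : flagC).

Lemma SO3_nu_zero q : nu_zero (coset (SO3_SU3 q)).
Proof. by rewrite /nu_zero /= nuE nu_mx_complexify //; exact: set_valP. Qed.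

Definition SO3_nu_zero_pt (q : SO3) : nu_zero := SigSub (mem_set (SO3_nu_zero q)).

Definition nu_zero_class (q : SO3) : nu_zero_orbits R :=
  \pi_(orbit_space (@ltorus_nu_zero_tg R)) (SO3_nu_zero_pt q).

Definition double_torus (m p : 'M[C]_3) : Prop :=
  exists a b c d, p = torus_mx a b *m m *m torus_mx c d.

Lemma eq_coset (p p' : SU3) :
  coset p = coset p' <-> exists a b, val p' = val p *m torus_mx a b.
Proof.
split=> [/eq_orbit[t ->]|[a [b E]]].
  by have [a [b ->]] := torus_eltP t; exists a, b.
by apply/eq_orbit; exists (torus_elt a b); apply/val_inj.
Qed.

(** The left torus factor comes from the orbit, the right one from the coset. Any representative [p]
    is allowed, so that the chosen [repr] can be used. *)
Lemma eq_nu_zero_class (p : SU3) (pz : nu_zero (coset p)) q :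
  nu_zero_class q = \pi_(orbit_space (@ltorus_nu_zero_tg R)) (SigSub (mem_set pz))
  <-> double_torus (complexify (val q)) (val p).
Proof.
split=> [/eq_orbit[t /(congr1 val)]|[a [b [c [d pE]]]]].
  rewrite /= ltorusE => /esym/eq_coset[c [d pE]].
  have [a [b tE]] := torus_eltP t; exists a, b, c, d.
  by rewrite pE tE.
apply/eq_orbit; exists (torus_elt a b); apply/val_inj; rewrite /= ltorusE.
by apply/esym/eq_coset; exists c, d.
Qed.

Lemma eq_nu_zero_class_SO3 q q' :
  nu_zero_class q = nu_zero_class q' <-> double_Z22 (val q) (val q').
Proof.
rewrite /nu_zero_class -/(nu_zero_class q) /SO3_nu_zero_pt eq_nu_zero_class.
have [qS q'S] := (set_valP q, set_valP q').
split=> [[a [b [c [d /esym E]]]]|[s sZ [t tZ E]]].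
  exact: (torus_orbit_real qS q'S E).
have [a [b sE]] := Z22_torus sZ; have [c [d tE]] := Z22_torus tZ.
by exists a, b, c, d; rewrite -sE -tE -!map_mxM -E.
Qed.

Lemma repr_nu_zero (X : nu_zero) : nu_zero (coset (repr (val X))).
Proof. by rewrite reprK; exact: set_valP. Qed.

Lemma repr_nu_zeroE (X : nu_zero) : SigSub (mem_set (repr_nu_zero X)) = X.
Proof. by apply/val_inj; rewrite /= reprK. Qed.

Lemma nu_zero_class_surj x : exists q, nu_zero_class q = x.
Proof.
rewrite -[x]reprK; set X := repr x.
have pS := set_valP (repr (val X)).
have [|q qS pE] := nu_mx_eq0_torus pS.
  by rewrite -nuE; exact: repr_nu_zero.
exists (SigSub (mem_set qS)); rewrite -[in RHS](repr_nu_zeroE X).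
exact/eq_nu_zero_class.
Qed.

Lemma cis_bounded (a : R) : exists2 a', -pi <= a' <= pi & cis a' = cis a :> C.
Proof. by have [a' api aE] := unit_angle (cos2Dsin2 a); exists a'. Qed.

Lemma torus_mx_bounded (a b : R) : exists a' b',
  [/\ -pi <= a' <= pi, -pi <= b' <= pi & torus_mx a b = torus_mx a' b'].
Proof.
have [a' a'pi aE] := cis_bounded a; have [b' b'pi bE] := cis_bounded b.
(* The third diagonal entry is the conjugate of the product of the first two, so reducing the angles
   preserves it. *)
by exists a', b'; split=> //; rewrite /torus_mx -!conj_cis !cisD aE bE.
Qed.

Definition double_torus_map (x : SO3 * ((R * R) * (R * R))) : 'M[C]_3 :=
  torus_mx x.2.1.1 x.2.1.2 *m complexify (val x.1) *m torus_mx x.2.2.1 x.2.2.2.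

Lemma complexify_continuous : continuous (@complexify R).
Proof.
apply: continuous_mx => i j.
rewrite (_ : (fun x => _) = fun q : 'M[R]_3 => (q i j)%:C).
  exact: continuous_comp_fun (@mx_entry_continuous _ _ _ i j) (@real_complex_continuous R).
by apply/funext => q; rewrite mxE.
Qed.

Lemma double_torus_map_continuous : continuous double_torus_map.
Proof.
have c1 : continuous (fun x : SO3 * ((R * R) * (R * R)) => x.1) by move=> x; exact: cvg_fst.
have c2 : continuous (fun x : SO3 * ((R * R) * (R * R)) => x.2) by move=> x; exact: cvg_snd.
have d1 : continuous (fun x : (R * R) * (R * R) => x.1) by move=> x; exact: cvg_fst.
have d2 : continuous (fun x : (R * R) * (R * R) => x.2) by move=> x; exact: cvg_snd.
have tc := @torus_mx_continuous R.
apply: mulmx_continuous; first apply: mulmx_continuous.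
- exact: continuous_comp_fun (continuous_comp_fun c2 d1) tc.
- exact: continuous_comp_fun (continuous_comp_fun c1 (@set_val_continuous _ SO3)) complexify_continuous.
- exact: continuous_comp_fun (continuous_comp_fun c2 d2) tc.
Qed.

(** With bounded angles the set is a continuous image of [F] times four segments, hence compact. *)
Lemma closed_double_torus (F : set SO3) : closed F ->
  closed [set p : 'M[C]_3 | exists2 q, F q & double_torus (complexify (val q)) p].
Proof.
move=> Fc; pose I : set R := `[-pi, pi]%classic.
have cF : compact F.
  exact: subclosed_compact Fc (compact_set_type (@SO3_compact R)) _.
have cI : compact I by exact: segment_compact.
have cK := compact_setX cF (compact_setX (compact_setX cI cI) (compact_setX cI cI)).
have := continuous_compact (continuous_subspaceT double_torus_map_continuous) cK.
move/(compact_closed (@norm_hausdorff _ 'M[C]_3)); congr closed.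
apply/seteqP; split=> [_ [[q [[a b] [c d]]] [/= Fq _] <-]|p [q Fq]].
  by exists q => //; exists a, b, c, d.
move=> [a [b [c [d ->]]]].
have [a' [b' [a'pi b'pi ->]]] := torus_mx_bounded a b.
have [c' [d' [c'pi d'pi ->]]] := torus_mx_bounded c d.
exists (q, ((a', b'), (c', d'))) => //.
Qed.

Lemma nu_zero_class_continuous : continuous nu_zero_class.
Proof.
have pc : continuous (fun q => coset (SO3_SU3 q)).
  apply: continuous_comp_fun (@pi_continuous _ _).
  apply: continuous_comp_initial.
  exact: continuous_comp_fun (@set_val_continuous _ SO3) complexify_continuous.
apply: continuous_comp_fun (@pi_continuous _ _).
exact: continuous_comp_initial.
Qed.

Lemma nu_zero_class_quotient (U : set (nu_zero_orbits R)) :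
  open (nu_zero_class @^-1` U) <-> open U.
Proof.
split=> [oU|oU]; last by have /continuousP/(_ _ oU) := nu_zero_class_continuous.
(* [K] is the saturation under both torus actions of the closed complement of the preimage of
   [U]. *)
pose K := [set p : 'M[C]_3 | exists2 q, (~` (nu_zero_class @^-1` U)) q &
  double_torus (complexify (val q)) p].
have Kc : closed K by apply: closed_double_torus; exact: open_closedC.
have KU (X : nu_zero) : K (val (repr (val X))) <->
    ~ U (\pi_(orbit_space (@ltorus_nu_zero_tg R)) X).
  split=> [[q Uq /(eq_nu_zero_class (repr_nu_zero X)) qX]|UX].
    by move: Uq; rewrite /= qX repr_nu_zeroE.
  have [q qX] := nu_zero_class_surj (\pi_(orbit_space (@ltorus_nu_zero_tg R)) X).
  exists q; first by rewrite /= qX.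
  by apply/(eq_nu_zero_class (repr_nu_zero X)); rewrite repr_nu_zeroE.
(* [K] is stable under the right torus action, so membership does not depend on the representative
   of a coset. *)
have Kcoset (p : SU3) : K (val (repr (coset p))) <-> K (val p).
  have [t ->] := repr_orbit (@rtorus_tg R) p; have [e [f ->]] := torus_eltP t.
  split=> -[q Uq [a [b [c [d E]]]]]; exists q => //; exists a, b.
    exists (c - e), (d - f); move: E; rewrite /= => /(congr1 (mulmx^~ (torus_mx (- e) (- f)))).
    by rewrite -!mulmxA torus_mxV mulmx1 torus_mxM => ->.
  by exists (c + e), (d + f); rewrite /= E -!mulmxA torus_mxM.
(* The zero level has the subspace topology, so an open set of flags with the right trace is needed;
   the complement of [K] supplies it. *)
apply/open_orbit_space; exists [set x : flagC | ~ K (val (repr x))].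
  apply/open_orbit_space.
  have oK : open ((set_val : SU3 -> 'M[C]_3) @^-1` (~` K)).
    have /continuousP := @set_val_continuous _ SU3; apply.
    exact: closed_openC.
  move: oK; congr open; apply/seteqP; split=> p /= Kp; by rewrite Kcoset in Kp *.
apply/seteqP; split=> X /=.
  by rewrite KU; exact: contrapT.
by move=> UX /KU.
Qed.

End Identification.

Theorem proposition4p2 (R : realType) :
  homeomorphic (nu_zero_orbits R) (flagR_orbits R).
Proof.
apply: (@homeomorphic_quotient_maps _ _ _ (@nu_zero_class R) (@flagR_class R)).
- exact: nu_zero_class_surj.
- exact: flagR_class_surj.
- by move=> q q'; rewrite eq_nu_zero_class_SO3 eq_flagR_class.
- exact: nu_zero_class_quotient.
- exact: flagR_class_quotient.
Qed.
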